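(* Let $\Omega\subset\mathbb{R}^n$ be any bounded domain, $s\in(0,1)$, $g\in L^2(\Omega)$, and let $u$ be the weak solution of $$\begin{cases}Lu=g&\text{in }\Omega,\\ u=0&\text{in }\mathbb{R}^n\setminus\Omega,\end{cases}$$ where $L$ is a nonlocal operator of the form $$Lu(x)=\int_{\mathbb{R}^n}\bigl(2u(x)-u(x+y)-u(x-y)\bigr)\frac{a(y/|y|)}{|y|^{n+2s}}\,dy,$$ with $a\in L^1(S^{n-1})$ nonnegative, $a(\theta)=a(-\theta)$ for $\theta\in S^{n-1}$, satisfying the ellipticity conditions $$\Lambda_1\le \inf_{\nu\in S^{n-1}}\int_{S^{n-1}}|\nu\cdot\theta|^{2s}a(\theta)\,d\theta,\qquad 0\le a(\theta)\le\Lambda_2\quad\text{for all }\theta\in S^{n-1},$$ where $\Lambda_1$ and $\Lambda_2$ are positive constants. Assume in addition that $g\in L^p(\Omega)$. Then: (a) If $1<p<\frac{n}{2s}$, then $$\|u\|_{L^q(\Omega)}\le C\|g\|_{L^p(\Omega)},\qquad q=\frac{np}{n-2ps},$$ where $C$ is a constant depending only on $n$, $s$, $p$ and $\Lambda_2$. (b) If $p=\frac{n}{2s}$, then $$\|u\|_{L^q(\Omega)}\le C\|g\|_{L^p(\Omega)}\qquad\text{for all } q<\infty,$$ where $C$ is a constant depending only on $n$, $s$, $q$, $\Omega$ and $\Lambda_2$. (c) If $\frac{n}{2s}<p<\infty$, then $$\|u\|_{L^\infty(\Omega)}\le C\|g\|_{L^p(\Omega)},$$ where $C$ is a constant depending only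 on $n$, $s$, $p$, $\Omega$ and $\Lambda_2$.
   Context: $S^{n-1}$ is the unit sphere of $\mathbb{R}^n$ (for $n=1$, $S^0=\{-1,1\}$ with counting measure). A weak solution of $Lu=g$ in $\Omega$, $u=0$ in $\mathbb{R}^n\setminus\Omega$, is understood in the usual sense: $u\in H^s(\mathbb{R}^n)$ vanishes a.e. outside $\Omega$ and $\iint (u(x)-u(x+y))(v(x)-v(x+y))\frac{a(y/|y|)}{|y|^{n+2s}}\,dx\,dy=\int_\Omega gv\,dx$ for all $v\in H^s(\mathbb{R}^n)$ vanishing a.e. outside $\Omega$.
   Formalization: C may also depend on Λ1 (for kernel ta, 0<t≤1, the solution with the same g is u/t, so a constant depending on Λ2 but not Λ1 is impossible); in (b), (c) p≥1 is required (for p<1, possible only if n=1, the bounds fail), and in (b) q≥1. *)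

(* Defs.v *)
From HB Require Import structures.
From mathcomp Require Import all_boot all_order all_algebra.
From mathcomp Require Import all_classical all_reals all_analysis.
From mathcomp Require Import measurable_realfun.

Set Implicit Arguments.
Unset Strict Implicit.
Unset Printing Implicit Defensive.

Import Order.TTheory GRing.Theory Num.Theory.
Import numFieldNormedType.Exports.

Local Open Scope classical_set_scope.
Local Open Scope ring_scope.

(* The sigma-algebra on row vectors generated by the coordinate maps; on
   'rV[R]_n it is the Borel sigma-algebra of R^n. *)
Definition measure_rV_display : measure_display -> measure_display.
Proof. exact. Qed.

Section measurable_rV.
Context {d} {T : sigmaRingType d} (n : nat).

Let coor (i : 'I_n) (x : 'rV[T]_n) : T := x ord0 i.

HB.instance Definition _ := @isMeasurable.Build (measure_rV_display d)
  'rV[T]_n (g_sigma_preimage coor) (@sigma_algebra0 _ _ _)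
  (@sigma_algebraC _ _ ) (@sigma_algebra_bigcup _ _ _).

Lemma measurable_coor (i : 'I_n) :
  measurable_fun [set: 'rV[T]_n] (fun x : 'rV[T]_n => x ord0 i).
Proof.
move=> _ Y mY; rewrite setTI; apply: sub_sigma_algebra => /=.
rewrite -bigcup_seq/=; exists i => /=; first by rewrite mem_index_enum.
by exists Y => //; rewrite setTI.
Qed.

End measurable_rV.

Lemma measurable_fun_coorP d1 d2 (T1 : measurableType d1)
    (T2 : measurableType d2) n (f : T1 -> 'rV[T2]_n) :
  (forall i, measurable_fun [set: T1] (fun x => f x ord0 i)) ->
  measurable_fun [set: T1] f.
Proof.
move=> mf _ Y mY; rewrite setTI.
pose G := image_set_system setT f measurable.
suff /(_ Y mY) : measurable `<=` G by rewrite /G /image_set_system/= setTI.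
apply: smallest_sub.
  exact/sigma_algebra_image/sigma_algebra_measurable.
rewrite -bigcup_seq => A [i _] [B mB <-].
rewrite /G /image_set_system/= !setTI -[X in measurable X]setTI.
exact: (mf i).
Qed.

Section lebesgue_rV.
Context {R : realType}.

Definition rV_cons n (p : R * 'rV[R]_n) : 'rV[R]_n.+1 :=
  row_mx (const_mx p.1 : 'rV[R]_1) p.2.

Lemma rV_cons0 n (p : R * 'rV[R]_n) : rV_cons p ord0 ord0 = p.1.
Proof.
rewrite (_ : ord0 = @lshift 1 n ord0); last exact/val_inj.
exact: etrans (row_mxEl _ _ _ _) (mxE _ _ _ _).
Qed.

Lemma rV_consS n (p : R * 'rV[R]_n) i :
  rV_cons p ord0 (lift ord0 i) = p.2 ord0 i.
Proof.
rewrite (_ : lift ord0 i = @rshift 1 n i); last exact/val_inj.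
exact: row_mxEr.
Qed.

Lemma measurable_rV_cons n : measurable_fun setT (@rV_cons n).
Proof.
apply: measurable_fun_coorP => i.
have [->|[j ->]] : i = ord0 \/ exists j, i = lift ord0 j.
  by case: (unliftP ord0 i) => [j|] ->; [right; exists j|left].
  rewrite (_ : (fun _ => _) = fst); first exact: measurable_fst.
  by apply/funext => p; rewrite rV_cons0.
rewrite (_ : (fun _ => _) = (fun x : 'rV[R]_n => x ord0 j) \o snd).
  by apply: measurableT_comp; [exact: measurable_coor|exact: measurable_snd].
by apply/funext => p; rewrite rV_consS.
Qed.

Section step.
Variables (n : nat) (m : {sigma_finite_measure set 'rV[R]_n -> \bar R}).

Let mu : {measure set (measurableTypeR R * 'rV[R]_n)%type -> \bar R} :=
  (@lebesgue_measure R \x m)%E.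

Definition lebesgue_cons : set 'rV[R]_n.+1 -> \bar R :=
  pushforward (@lebesgue_measure R \x m)%E (@rV_cons n).

Let nu := pushforward mu (@rV_cons n).

Let nu0 : lebesgue_cons set0 = 0%E.
Proof. by rewrite /lebesgue_cons /pushforward preimage_set0; exact: (measure0 mu). Qed.

Let nu_ge0 A : (0 <= lebesgue_cons A)%E.
Proof. exact: (measure_ge0 mu). Qed.

Let nu_sigma_additive : semi_sigma_additive lebesgue_cons.
Proof.
apply: (@measure_semi_sigma_additive _ _ _ nu).
exact: measurable_rV_cons.
Qed.

HB.instance Definition _ := isMeasure.Build _ _ _ lebesgue_cons
  nu0 nu_ge0 nu_sigma_additive.

Let nu_sigma_finite : sigma_finite setT lebesgue_cons.
Proof.
have /sigma_finiteP[F [TF ndF Foo]] := sigma_finiteT (@lebesgue_measure R).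
have /sigma_finiteP[G [TG ndG Goo]] := sigma_finiteT m.
pose h (x : 'rV[R]_n.+1) : R * 'rV[R]_n :=
  (x ord0 ord0, \row_i x ord0 (lift ord0 i)).
have hK : cancel (@rV_cons n) h.
  move=> [x y]; rewrite /h rV_cons0; congr (_, _).
  by apply/rowP => i; rewrite mxE rV_consS.
have mh : measurable_fun setT h.
  apply/measurable_fun_pairP; split; first exact: measurable_coor.
  apply: measurable_fun_coorP => i.
  rewrite (_ : (fun _ => _) = (fun x : 'rV[R]_n.+1 => x ord0 (lift ord0 i))).
    exact: measurable_coor.
  by apply/funext => x; rewrite /= mxE.
exists (fun k => h @^-1` (F k `*` G k)).
  apply/seteqP; split=> // x _.
  have [i _ Fi] : (\bigcup_i F i) (h x).1 by rewrite -TF.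
  have [j _ Gj] : (\bigcup_i G i) (h x).2 by rewrite -TG.
  exists (maxn i j) => //; split.
    by move: Fi; exact/subsetPset/ndF/leq_maxl.
  by move: Gj; exact/subsetPset/ndG/leq_maxr.
move=> k; have [mF Fk] := Foo k; have [mG Gk] := Goo k.
have mFG : measurable (F k `*` G k) by exact: measurableX.
split; first by rewrite -[X in measurable X]setTI; exact: mh.
rewrite /lebesgue_cons /pushforward -comp_preimage (_ : h \o _ = id); last first.
  exact/funext.
by rewrite preimage_id product_measure1E// lte_mul_pinfty// ge0_fin_numE.
Qed.

HB.instance Definition _ := Measure_isSigmaFinite.Build _ _ _ lebesgue_cons
  nu_sigma_finite.

End step.

(* Lebesgue measure on R^n: the n-fold product of the one-dimensional one. *)
Fixpoint lebesgue_rV n : {sigma_finite_measure set 'rV[R]_n -> \bar R} :=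
  if n is n'.+1 then lebesgue_cons (lebesgue_rV n') else \d_(0 : 'rV[R]_0).

Lemma lebesgue_rV_box n (A : 'I_n -> set R) : (forall i, measurable (A i)) ->
  lebesgue_rV n [set x | forall i, A i (x ord0 i)] =
  (\prod_(i < n) lebesgue_measure (A i))%E.
Proof.
elim: n A => [|n IHn] A mA.
  by rewrite big_ord0 /= diracE mem_set// => -[i i0].
rewrite big_ord_recl -IHn//= /lebesgue_cons /pushforward.
pose B := [set x : 'rV[R]_n | forall i, A (lift ord0 i) (x ord0 i)].
have mB : measurable B.
  rewrite (_ : B = \bigcap_(i in [set: 'I_n])
      ((fun x : 'rV[R]_n => x ord0 i) @^-1` A (lift ord0 i))).
    apply: fin_bigcap_measurable => // i _.
    by rewrite -[X in measurable X]setTI; exact: measurable_coor.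
  by apply/seteqP; split=> x Ax i; [move=> _|]; exact: Ax.
rewrite -(@product_measure1E _ _ _ _ _ (@lebesgue_measure R) (lebesgue_rV n))//.
congr (_ _); apply/seteqP; split=> -[x y] /= xy.
  split=> [|i]; first by have := xy ord0; rewrite rV_cons0.
  by have := xy (lift ord0 i); rewrite rV_consS.
by move=> i; case: (unliftP ord0 i) => [j|] ->; rewrite ?rV_cons0 ?rV_consS;
  [exact: xy.2|exact: xy.1].
exact: mA.
Qed.

End lebesgue_rV.

Section euclidean_sphere.
Context {R : realType} (n : nat).
Implicit Types x y : 'rV[R]_n.

Definition dotp x y : R := \sum_i x ord0 i * y ord0 i.

(* The norm `|x| of the library on 'rV[R]_n is the sup norm. *)
Definition enorm x : R := Num.sqrt (dotp x x).

Definition sphere : set 'rV[R]_n := [set x | enorm x = 1].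

Definition direction x : 'rV[R]_n := (enorm x)^-1 *: x.

Definition punctured_unit_ball : set 'rV[R]_n := [set x | 0 < enorm x <= 1].

Lemma dotp_ge0 x : 0 <= dotp x x.
Proof. by apply: sumr_ge0 => i _; rewrite -expr2 sqr_ge0. Qed.

Lemma measurable_enorm : measurable_fun setT enorm.
Proof.
rewrite (_ : enorm = (@powR R ^~ 2^-1) \o (fun x => dotp x x)); last first.
  by apply/funext => x; rewrite /= powR12_sqrt// dotp_ge0.
apply: measurableT_comp; first exact: measurable_powR.
apply: measurable_sum => i.
by apply: measurable_funM; exact: measurable_coor.
Qed.

Lemma measurable_direction : measurable_fun setT direction.
Proof.
apply: measurable_fun_coorP => i.
rewrite (_ : (fun _ => _) = (fun x => (enorm x)^-1 * x ord0 i)); last first.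
  by apply/funext => x; rewrite mxE.
apply: measurable_funM; last exact: measurable_coor.
rewrite (_ : (fun _ => _) = (@powR R ^~ (-1)) \o enorm); last first.
  by apply/funext => x; rewrite /= powR_inv1// sqrtr_ge0.
by apply: measurableT_comp; [exact: measurable_powR|exact: measurable_enorm].
Qed.

Lemma measurable_punctured_unit_ball : measurable punctured_unit_ball.
Proof.
rewrite (_ : punctured_unit_ball = enorm @^-1` `]0, 1]).
  by rewrite -[X in measurable X]setTI; exact: measurable_enorm.
by apply/seteqP; split=> x; rewrite /= in_itv.
Qed.

(* Surface measure on the unit sphere, as a measure on R^n concentrated on
   the sphere: sigma(A) = n |{r w : w in A, 0 < r <= 1}|. For n = 1 it is the
   counting measure on {-1, 1}. *)
Definition sphere_measure : set 'rV[R]_n -> \bar R :=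
  fun A => (n%:R%:E *
    lebesgue_rV n (direction @^-1` A `&` punctured_unit_ball))%E.

Let sigma : {measure set 'rV[R]_n -> \bar R} := mscale n%:R%:nng
  (mrestr (lebesgue_rV n) measurable_punctured_unit_ball).

Let sphere_measureE : sphere_measure = pushforward sigma direction.
Proof. by []. Qed.

Let sphere_measure0 : sphere_measure set0 = 0%E.
Proof. by rewrite sphere_measureE /pushforward preimage_set0 measure0. Qed.

Let sphere_measure_ge0 A : (0 <= sphere_measure A)%E.
Proof. exact: (measure_ge0 sigma). Qed.

Let sphere_measure_sigma_additive : semi_sigma_additive sphere_measure.
Proof.
rewrite sphere_measureE.
apply: (@measure_semi_sigma_additive _ _ _ (pushforward sigma direction)).
exact: measurable_direction.
Qed.

HB.instance Definition _ := isMeasure.Build _ _ _ sphere_measure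
  sphere_measure0 sphere_measure_ge0 sphere_measure_sigma_additive.

End euclidean_sphere.

Section stable_operator.
Context {R : realType} (n : nat).
Implicit Types (Omega : set 'rV[R]_n) (a u v g : 'rV[R]_n -> R).

Local Notation leb := (@lebesgue_rV R n).

Definition bounded_domain Omega : Prop :=
  [/\ Omega !=set0, open Omega, connected Omega & bounded_set Omega].

(* Functions on Omega are represented by functions on R^n of which only the
   values on Omega matter; f \_ Omega is f on Omega and 0 elsewhere. *)
Definition in_Lp Omega (p : \bar R) (f : 'rV[R]_n -> R) : Prop :=
  f \_ Omega \in Lfun leb p.

Definition Lp_norm Omega (p : \bar R) (f : 'rV[R]_n -> R) : \bar R :=
  ('N[leb]_p[EFin \o (f \_ Omega)])%E.

(* H^s(R^n), with the Gagliardo seminorm. *)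
Definition in_Hs (s : R) u : Prop :=
  in_Lp setT 2%:E u /\
  (\int[leb \x leb]_z
     (`|u z.1 - u z.2| ^+ 2 / enorm (z.1 - z.2) `^ (n%:R + 2 * s))%:E
   < +oo)%E.

Definition vanishes_outside Omega u : Prop :=
  {ae leb, forall x, ~ Omega x -> u x = 0}.

(* An estimate of u by g whose constant is uniform over all admissible a
   must let the constant depend on Lambda1 as well as on Lambda2: replacing a
   by t * a with 0 < t <= 1 preserves a <= Lambda2 and the datum g, but
   replaces the solution u by t^-1 * u. *)
Definition admissible_kernel (s Lambda1 Lambda2 : R) a : Prop :=
  [/\ a \_ (@sphere R n) \in Lfun (@sphere_measure R n) 1%E,
      forall theta, sphere theta -> a (- theta) = a theta,
      (Lambda1%:E <= ereal_inf
         [set \int[@sphere_measure R n]_(theta in @sphere R n)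
                (`|dotp nu theta| `^ (2 * s) * a theta)%:E
         | nu in @sphere R n])%E &
      forall theta, sphere theta -> 0 <= a theta <= Lambda2].

(* The weak formulation of L u = g in Omega, u = 0 outside Omega, where
     L u (x) = \int (2 u(x) - u(x+y) - u(x-y)) a(y/|y|) / |y|^(n+2s) dy. *)
Definition weak_solution (s : R) a Omega g u : Prop :=
  [/\ in_Hs s u, vanishes_outside Omega u &
      forall v, in_Hs s v -> vanishes_outside Omega v ->
        (\int[leb \x leb]_z
           ((u z.1 - u (z.1 + z.2)) * (v z.1 - v (z.1 + z.2)) *
            (a (direction z.2) / enorm z.2 `^ (n%:R + 2 * s)))%:E
         = \int[leb]_(x in Omega) (g x * v x)%:E)%E].

End stable_operator.

(* Main.v *)
Require Import Defs.
From mathcomp Require Import all_boot all_order all_algebra.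
From mathcomp Require Import all_classical all_reals all_analysis.
From mathcomp Require Import measurable_realfun ess_sup_inf ring lra.

(* Energy method with constants depending on Lambda1. Since a <= Lambda2 and the
   mass of a is at least Lambda1, a is bounded below on a set of directions of
   definite measure, so the kernel K(y) = a(y/|y|) / |y|^(n+2s) charges the
   complement of any set E with |E| <= b: the integral of K over {x + y notin E}
   is at least c b^(-2s/n), uniformly in x. Testing the equation with phi(u), phi
   odd, nondecreasing and Lipschitz, and keeping for each x only the y with
   |u(x+y)| <= k gives, for k <= h <= |u(x)|, the inner lower bound
   (h - k) (phi h - phi k) c |{|u| > k}|^(-2s/n).
   - With phi the truncation of u between the levels k < h, Hoelder's inequality
     yields |{|u| > h}| <= C ||g||_p |{|u| > k}|^(1 - 1/p + 2s/n) / (h - k):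
     for p > n/2s Stampacchia's iteration makes a superlevel set null, and for
     p = n/2s the superlevel sets decay geometrically, which gives every L^q.
   - With phi a power |u|^b cut off above and near 0, h = |u(x)| and k = h/2, the
     measure of {|u| > h/2} is bounded through Chebyshev by the L^q norm of u
     itself; for b = q (p - 1) / p all powers balance and ||u||_q <= C ||g||_p. *)

Set Implicit Arguments.
Unset Strict Implicit.
Unset Printing Implicit Defensive.

Import Order.TTheory GRing.Theory Num.Theory.
Import numFieldNormedType.Exports.

Local Open Scope classical_set_scope.
Local Open Scope ring_scope.

(** * Lebesgue measure under scalings and translations *)

Section lebesgue_rV_affine.
Context {R : realType}.

(** The scaled image measure agrees with Lebesgue measure on half-open intervals, hence everywhere
    by uniqueness. *)
Lemma lebesgue_measure_affine (r b : R) (A : set (measurableTypeR R)) :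
  0 < r -> measurable A ->
  (r%:E * lebesgue_measure ((fun t : R => (r * t + b)%R) @^-1` A))%E =
  lebesgue_measure A.
Proof.
move=> r0 mA.
pose f : measurableTypeR R -> measurableTypeR R := fun t => r * t + b.
have mf : measurable_fun setT f.
  apply: measurable_funD => //; apply: measurable_funM => //.
pose m : {measure set (measurableTypeR R) -> \bar R} :=
  mscale (NngNum (ltW r0)) (pushforward (@lebesgue_measure R) f).
transitivity (m mf A); first by [].
apply/esym/(@lebesgue_measure_unique R (m mf)) => // _ [[c d] _ <-].
rewrite /m/= /mscale/= /pushforward.
rewrite (_ : f @^-1` _ = `](c - b) / r, (d - b) / r]%classic); last first.
  apply/seteqP; split=> t /=; rewrite !in_itv/= /f ltr_pdivrMr// ler_pdivlMr//
    ltrBlDr lerBrDr mulrC//.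
rewrite !lebesgue_measure_itv/= !lte_fin ltr_pM2r ?invr_gt0// ltrD2r.
case: ifPn => _; last by rewrite mule0.
rewrite -!EFinB -EFinM; congr EFin.
by rewrite mulrBr ![r * (_ / r)]mulrCA divff ?gt_eqF// !mulr1; ring.
Qed.

Lemma measurable_affine_rV n (r : R) (b : 'rV[R]_n) :
  measurable_fun setT (fun x : 'rV[R]_n => r *: x + b).
Proof.
apply: measurable_fun_coorP => i.
rewrite (_ : (fun _ => _) = (fun x : 'rV[R]_n => r * x ord0 i + b ord0 i)).
  by apply: measurable_funD => //; apply: measurable_funM => //;
    exact: measurable_coor.
by apply/funext => x; rewrite !mxE.
Qed.

(** Induction on [n]: through [rV_cons] the affine map splits into its first coordinate and the
    others, and uniqueness of the product measure reduces the claim to rectangles. *)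
Lemma lebesgue_rV_affine n (r : R) (b : 'rV[R]_n) (A : set 'rV[R]_n) :
  0 < r -> measurable A ->
  ((r ^+ n)%:E * lebesgue_rV n ((fun x => (r *: x + b)%R) @^-1` A))%E =
  lebesgue_rV n A.
Proof.
move=> r0; elim: n b A => [|n IHn] b A mA.
  by rewrite expr0 mul1e; congr (_ _); apply/seteqP; split=> x;
    rewrite /preimage/= (thinmx0 (r *: x + b)) (thinmx0 x).
pose b0 : R := b ord0 ord0; pose b' : 'rV[R]_n := \row_i b ord0 (lift ord0 i).
pose f (p : measurableTypeR R * 'rV[R]_n) : measurableTypeR R * 'rV[R]_n :=
  (r * p.1 + b0, r *: p.2 + b').
have mf1 : measurable_fun setT (fun t : measurableTypeR R => r * t + b0).
  by apply: measurable_funD => //; exact: measurable_funM.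
have mf : measurable_fun setT f.
  apply/measurable_fun_pairP; split.
    exact: (measurableT_comp mf1 measurable_fst).
  exact: (measurableT_comp (measurable_affine_rV r b') measurable_snd).
pose mu : {measure set (measurableTypeR R * 'rV[R]_n)%type -> \bar R} :=
  (@lebesgue_measure R \x lebesgue_rV n)%E.
pose m : {measure set (measurableTypeR R * 'rV[R]_n)%type -> \bar R} :=
  mscale (NngNum (exprn_ge0 n.+1 (ltW r0))) (pushforward mu f).
have mE X : measurable X -> mu X = m mf X.
  apply: product_measure_unique => B C mB mC.
  rewrite /m/= /mscale/= /pushforward.
  rewrite (_ : f @^-1` _ = ((fun t => r * t + b0) @^-1` B) `*`
     ((fun x => r *: x + b') @^-1` C)) //.
  rewrite product_measure1E//; last 2 first.
  - by rewrite -[X in measurable X]setTI; exact: mf1.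
  - by rewrite -[X in measurable X]setTI; exact: measurable_affine_rV.
  rewrite exprS EFinM muleACA -(IHn b' C mC) -(lebesgue_measure_affine b0 r0 mB).
  by [].
have mc : measurable (@rV_cons R n @^-1` A).
  by rewrite -[X in measurable X]setTI; exact: measurable_rV_cons.
have consE B : lebesgue_rV n.+1 B = mu (@rV_cons R n @^-1` B) by [].
have affE k (x y : 'rV[R]_k) i : (r *: x + y) ord0 i = r * x ord0 i + y ord0 i.
  by rewrite !mxE.
have b'E i : b' ord0 i = b ord0 (lift ord0 i) by rewrite mxE.
have fE : @rV_cons R n @^-1` ((fun x => r *: x + b) @^-1` A) =
    f @^-1` (@rV_cons R n @^-1` A).
  suff H p : r *: rV_cons p + b = rV_cons (f p).
    by apply/seteqP; split=> p; rewrite /preimage /= H.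
  apply/rowP => i; rewrite affE.
  by case: (unliftP ord0 i) => [j|] ->; rewrite ?rV_cons0 ?rV_consS//= affE b'E.
have mfE X : m mf X = ((r ^+ n.+1)%:E * mu (f @^-1` X))%E by [].
by rewrite !consE fE (mE _ mc) mfE.
Qed.

End lebesgue_rV_affine.

(** * Open sets and cubes in R^n *)

Section borel_rV.
Context {R : realType} (n : nat).

Lemma measurable_box (A : 'I_n -> set R) : (forall i, measurable (A i)) ->
  measurable [set x : 'rV[R]_n | forall i, A i (x ord0 i)].
Proof.
move=> mA; rewrite (_ : mkset _ = \bigcap_(i in [set: 'I_n])
    ((fun x : 'rV[R]_n => x ord0 i) @^-1` A i)).
  apply: fin_bigcap_measurable => // i _.
  by rewrite -[X in measurable X]setTI; exact: measurable_coor.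
by apply/seteqP; split=> x Ax i; [move=> _|]; exact: Ax.
Qed.

(** The sigma-algebra is generated by coordinates, so an open set is written as a countable union of
    boxes with rational corners. *)
Lemma open_measurable_rV (A : set 'rV[R]_n) : open A -> measurable A.
Proof.
move=> oA; pose B (ab : 'rV[rat]_n * 'rV[rat]_n) : set 'rV[R]_n :=
  [set x | forall i, `]ratr (ab.1 ord0 i), ratr (ab.2 ord0 i)[%classic (x ord0 i)].
(* Boxes not contained in [A] are replaced by the empty set, so that the union runs over all pairs
   of rational corners. *)
pose F ab := if `[< B ab `<=` A >] then B ab else set0.
rewrite (_ : A = \bigcup_ab F ab).
  apply: countable_bigcupT_measurable => // ab.
  rewrite /F; case: ifPn => _ //.
  by apply: (@measurable_box (fun i =>
    `]ratr (ab.1 ord0 i), ratr (ab.2 ord0 i)[%classic)).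
apply/seteqP; split=> [x Ax|x [ab _]]; last first.
  by rewrite /F; case: ifPn => // /asboolP BA /BA.
have /nbhs_ballP[e /= e0 xA] : nbhs x A by apply: open_nbhs_nbhs.
have a_ i : exists q : rat, x ord0 i - e < ratr q < x ord0 i.
  have [q] := @rat_in_itvoo R (x ord0 i - e) (x ord0 i) ltac:(by rewrite ltrBlDr ltrDl).
  by rewrite in_itv/= => qe; exists q.
have b_ i : exists q : rat, x ord0 i < ratr q < x ord0 i + e.
  have [q] := @rat_in_itvoo R (x ord0 i) (x ord0 i + e) ltac:(by rewrite ltrDl).
  by rewrite in_itv/= => qe; exists q.
have /choice[a ae] := a_; have /choice[b be] := b_.
exists (\row_i a i, \row_i b i) => //.
have BA : B (\row_i a i, \row_i b i) `<=` A.
  move=> y By; apply: xA; split=> // i j; rewrite (ord1 i).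
  have := By j; rewrite /= !mxE in_itv/= /ball/= => /andP[y1 y2].
  have /andP[a1 a2] := ae j; have /andP[b1 b2] := be j.
  by rewrite ltr_distlC; apply/andP; split; lra.
rewrite /F; case: ifPn => [_|/asboolP//] i /=.
rewrite !mxE in_itv/=.
by have /andP[_ ->] := ae i; have /andP[-> _] := be i.
Qed.

Lemma ler_coor_norm (x : 'rV[R]_n) i : `|x ord0 i| <= `|x|.
Proof.
have /mapP[j Hj ->] : `|x ord0 i| \in [seq `|x x0.1 x0.2| | x0 : 'I_1 * 'I_n].
  by apply/mapP; exists (ord0, i) => //=; rewrite mem_enum.
by rewrite [leRHS]/Num.norm /= mx_normrE; apply/bigmax_geP; right => /=; exists j.
Qed.

Definition cube (M : R) : set 'rV[R]_n :=
  [set x | forall i, `[- M, M]%classic (x ord0 i)].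

Lemma measurable_cube M : measurable (cube M).
Proof. by apply: (@measurable_box (fun=> `[- M, M]%classic)). Qed.

Lemma lebesgue_cube M : 0 < M -> lebesgue_rV n (cube M) = ((M *+ 2) ^+ n)%:E.
Proof.
move=> M0; rewrite (lebesgue_rV_box (A := fun=> `[- M, M]%classic))//.
under eq_bigr do
  rewrite lebesgue_measure_itv/= lte_fin gtrN// opprK -EFinD -mulr2n.
by rewrite -(big_morph EFin EFinM erefl) prodr_const card_ord.
Qed.

Lemma bounded_sub_cube (A : set 'rV[R]_n) : bounded_set A ->
  exists2 M, 0 < M & A `<=` cube M.
Proof.
move=> [M [Mreal AM]]; exists (`|M| + 1); first by rewrite ltr_wpDl.
move=> x Ax i /=; rewrite in_itv/= -ler_norml.
apply: (le_trans (ler_coor_norm x i)); apply: AM => //.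
by rewrite (le_lt_trans (ler_norm M))// ltrDl.
Qed.

Lemma ler_coor_enorm (x : 'rV[R]_n) i : `|x ord0 i| <= enorm x.
Proof.
rewrite /enorm -sqrtr_sqr ler_wsqrtr// /dotp (bigD1 i)//= -expr2 lerDl.
by apply: sumr_ge0 => j _; rewrite -expr2 sqr_ge0.
Qed.

Lemma punctured_unit_ball_sub : @punctured_unit_ball R n `<=` cube 1.
Proof.
move=> x /andP[_ x1] i /=; rewrite in_itv/= -ler_norml.
exact: le_trans (ler_coor_enorm x i) x1.
Qed.

End borel_rV.

(** * Euclidean norm and truncated cones *)

Section euclidean_norm.
Context {R : realType} (n : nat).
Implicit Types x y : 'rV[R]_n.

Lemma enorm_ge0 x : 0 <= enorm x.
Proof. exact: sqrtr_ge0. Qed.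

Lemma enorm0 : enorm (0 : 'rV[R]_n) = 0.
Proof.
by rewrite /enorm /dotp big1 ?sqrtr0// => i _; rewrite mxE mul0r.
Qed.

Lemma enormZ r x : enorm (r *: x) = `|r| * enorm x.
Proof.
rewrite /enorm -sqrtr_sqr -sqrtrM ?sqr_ge0//; congr Num.sqrt.
by rewrite /dotp mulr_sumr; apply: eq_bigr => i _; rewrite !mxE; ring.
Qed.

Lemma enorm_eq0 x : enorm x = 0 -> x = 0.
Proof.
move=> x0; apply/rowP => i; rewrite mxE; apply/normr0_eq0/eqP.
by rewrite -normr_le0 normr_id -x0 ler_coor_enorm.
Qed.

Lemma directionZ r x : 0 < r -> direction (r *: x) = direction x.
Proof.
move=> r0; rewrite /direction enormZ gtr0_norm// scalerA invfM.
by rewrite mulrAC mulVf ?gt_eqF// mul1r.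
Qed.

Lemma sphere_direction x : enorm x != 0 -> sphere (direction x).
Proof.
move=> x0; rewrite /sphere/= /direction enormZ ger0_norm ?invr_ge0 ?enorm_ge0//.
by rewrite mulVf.
Qed.

Lemma measurable_sphere : measurable (@sphere R n).
Proof.
rewrite (_ : @sphere R n = @enorm R n @^-1` [set 1])//.
by rewrite -[X in measurable X]setTI; exact: measurable_enorm.
Qed.

Lemma dotp_enorm x : dotp x x = enorm x ^+ 2.
Proof. by rewrite /enorm sqr_sqrtr// dotp_ge0. Qed.

(** For unit vectors, Cauchy-Schwarz follows by summing |a b| <= (a^2 + b^2) / 2 over the
    coordinates. *)
Lemma dotp_sphere_le1 x y : sphere x -> sphere y -> `|dotp x y| <= 1.
Proof.
rewrite /sphere/= => x1 y1.
have : `|dotp x y| <= \sum_i (x ord0 i * x ord0 i + y ord0 i * y ord0 i) / 2.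
  apply: (le_trans (ler_norm_sum _ _ _)); apply: ler_sum => i _.
  set a := x ord0 i; set b := y ord0 i.
  have := sqr_ge0 (a - b); have := sqr_ge0 (a + b).
  by rewrite ler_norml !expr2 => ? ?; apply/andP; split; lra.
rewrite -mulr_suml big_split/= -/(dotp x x) -/(dotp y y) !dotp_enorm x1 y1.
by move=> /le_trans; apply; lra.
Qed.

(** For [r] = 1 this is the set whose volume defines [sphere_measure]. The origin, where [direction]
    has the default value 0, is left out. *)
Definition cone (D : set 'rV[R]_n) (r : R) : set 'rV[R]_n :=
  [set y | 0 < enorm y <= r /\ D (direction y)].

Lemma measurable_cone D r : measurable D -> measurable (cone D r).
Proof.
move=> mD; rewrite (_ : cone D r =
    (@enorm R n @^-1` `]0, r]) `&` (@direction R n @^-1` D)).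
  apply: measurableI; rewrite -[X in measurable X]setTI.
    exact: measurable_enorm.
  exact: measurable_direction.
by apply/seteqP; split=> y; rewrite /cone/= in_itv.
Qed.

Lemma lebesgue_cone D r : 0 < r -> measurable D ->
  lebesgue_rV n (cone D r) = ((r ^+ n)%:E * lebesgue_rV n (cone D 1))%E.
Proof.
move=> r0 mD; rewrite -(lebesgue_rV_affine 0 r0 (measurable_cone r mD)).
congr (_ * lebesgue_rV n _)%E.
have rE y : (r * enorm y <= r) = (enorm y <= 1).
  by rewrite -[leRHS]mulr1 ler_pM2l.
by apply/seteqP; split=> y;
  rewrite /cone /preimage/= addr0 enormZ gtr0_norm// directionZ// pmulr_rgt0// rE.
Qed.

Lemma sphere_measureE_cone D :
  sphere_measure D = (n%:R%:E * lebesgue_rV n (cone D 1))%E.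
Proof.
rewrite /sphere_measure; congr (_ * lebesgue_rV n _)%E.
by apply/seteqP; split=> y; rewrite /cone/= => -[].
Qed.

Lemma lebesgue_cone1_le D : measurable D ->
  (lebesgue_rV n (cone D 1) <= (2 ^+ n)%:E)%E.
Proof.
move=> mD; rewrite -(lebesgue_cube n (@ltr01 R)).
apply: le_measure; rewrite ?inE; first exact: measurable_cone.
  exact: measurable_cube.
by move=> y [yb _]; apply: punctured_unit_ball_sub.
Qed.

End euclidean_norm.

Lemma ge0_le_EFin (R : realDomainType) (x : \bar R) (r : R) :
  (0 <= x)%E -> (x <= r%:E)%E -> exists2 v, x = v%:E & 0 <= v <= r.
Proof.
case: x => [v| |//]; last by rewrite leye_eq => _ /eqP.
by rewrite !lee_fin => v0 vr; exists v; rewrite ?v0.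
Qed.

Lemma measurable_comp_powR d (T : measurableType d) (R : realType) (D : set T)
    (f : T -> R) (p : R) :
  measurable_fun D f -> measurable_fun D (fun x => f x `^ p).
Proof.
exact: (@measurableT_comp _ _ _ _ _ _ (@powR R ^~ p)).
Qed.

(** * Lower bound for the kernel off a set of finite measure *)

Section kernel_tail.
Context {R : realType} (n : nat) (s Lambda1 Lambda2 : R).
Hypotheses (n_gt0 : (0 < n)%N) (s_gt0 : 0 < s).
Hypotheses (Lambda1_gt0 : 0 < Lambda1) (Lambda2_gt0 : 0 < Lambda2).

Local Notation leb := (@lebesgue_rV R n).

Definition kernel (a : 'rV[R]_n -> R) (y : 'rV[R]_n) : R :=
  a (direction y) / enorm y `^ (n%:R + 2 * s).

Let exponent_gt0 : 0 < n%:R + 2 * s :> R.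
Proof. by rewrite addr_gt0 ?ltr0n// mulr_gt0. Qed.

Variable a : 'rV[R]_n -> R.
Hypothesis adm : admissible_kernel s Lambda1 Lambda2 a.

(** Here the inverse of 0 is 0; this settles the only point at which [direction] leaves the sphere
    and [a] is not controlled. *)
Lemma kernel0 : kernel a 0 = 0.
Proof. by rewrite /kernel enorm0 powR0 ?gt_eqF// invr0 mulr0. Qed.

Lemma kernel_ge0 y : 0 <= kernel a y.
Proof.
have [y0|y0] := eqVneq (enorm y) 0.
  by rewrite (enorm_eq0 y0) kernel0.
rewrite /kernel divr_ge0 ?powR_ge0//.
have [_ _ _ aE] := adm.
by have /andP[] := aE _ (sphere_direction y0).
Qed.

Let measurable_a : measurable_fun setT (a \_ (@sphere R n)).
Proof. by case: adm => /sub_Lfun_mfun; rewrite inE. Qed.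

Lemma measurable_kernel : measurable_fun setT (kernel a).
Proof.
rewrite (_ : kernel a = fun y => (a \_ (@sphere R n)) (direction y) *
    (enorm y `^ (n%:R + 2 * s)) `^ (-1)).
  apply: measurable_funM.
    exact: (measurableT_comp measurable_a (@measurable_direction R n)).
  apply: measurable_comp_powR.
  by apply: measurable_comp_powR; exact: measurable_enorm.
apply/funext => y; rewrite powR_inv1 ?powR_ge0// /kernel.
have [y0|y0] := eqVneq (enorm y) 0.
  by rewrite y0 powR0 ?gt_eqF// invr0 !mulr0.
by rewrite patchE mem_set//; exact: sphere_direction.
Qed.

(** The sphere has surface measure at most n 2^n, so values of [a] below [cone_floor] contribute at
    most Lambda1 / 2 to the ellipticity integral. The other half must come from directions with [a]
    at least [cone_floor]; as a <= Lambda2, these span a unit cone of volume at least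
    [cone_mass]. *)
Definition cone_floor : R := Lambda1 / (2 * n%:R * 2 ^+ n).
Definition cone_mass : R := Lambda1 / (2 * n%:R * Lambda2).

Let floor_gt0 : 0 < cone_floor.
Proof. by rewrite divr_gt0// !mulr_gt0 ?exprn_gt0// ltr0n. Qed.

Let mass_gt0 : 0 < cone_mass.
Proof. by rewrite divr_gt0// !mulr_gt0// ltr0n. Qed.

Let D : set 'rV[R]_n := [set theta | sphere theta /\ cone_floor <= a theta].

Let measurable_D : measurable D.
Proof.
rewrite (_ : D = (a \_ (@sphere R n)) @^-1` `[cone_floor, +oo[).
  by rewrite -[X in measurable X]setTI; exact: measurable_a.
apply/seteqP; split=> y; rewrite /D /preimage/= in_itv/= andbT patchE.
  by case=> sy ay; rewrite mem_set.
case: ifPn => [/set_mem sy ay //|_].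
by rewrite leNgt floor_gt0.
Qed.

Lemma lebesgue_cone_ge : (cone_mass%:E <= leb (cone D 1))%E.
Proof.
have [_ _ La aE] := adm.
(* A single unit vector suffices, since the weight |nu . theta|^(2s) is then bounded by 1. *)
pose nu : 'rV[R]_n := delta_mx ord0 (Ordinal n_gt0).
have snu : sphere nu.
  rewrite /sphere/= /enorm /dotp (bigD1 (Ordinal n_gt0))//= big1 => [|i i0].
    by rewrite !mxE !eqxx mulr1 addr0 sqrtr1.
  by rewrite !mxE (negbTE i0) andbF mulr0.
have mS := @measurable_sphere R n.
pose sg : {measure set 'rV[R]_n -> \bar R} := @sphere_measure R n.
have L1 : (Lambda1%:E <= \int[sg]_(theta in @sphere R n)
    (cone_floor + Lambda2 * \1_D theta)%:E)%E.
  apply: (le_trans La); apply: (@le_trans _ _ (\int[sg]_(theta in @sphere R n)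
      (`|dotp nu theta| `^ (2 * s) * a theta)%:E)%E).
    by apply: ereal_inf_lbound; exists nu.
  apply: ge0_le_integral => //.
  - move=> t /aE/andP[a0 _]; rewrite lee_fin mulr_ge0// powR_ge0//.
  - apply/measurable_EFinP; apply: measurable_funM; last first.
      by apply/(measurable_restrictT _ _).2.
    apply: measurable_funTS; apply: measurable_comp_powR.
    apply: measurableT_comp => //; apply: measurable_sum => i.
    by apply: measurable_funM => //; exact: measurable_coor.
  - apply/measurable_EFinP; apply: measurable_funTS; apply: measurable_funD => //.
    by apply: measurable_funM.
  move=> t st; rewrite lee_fin; have /andP[a0 a2] := aE _ st.
  apply: (@le_trans _ _ (a t)).
    rewrite ler_piMl//; apply: (@le_trans _ _ (1 `^ (2 * s))); last by rewrite powR1.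
    apply: ge0_ler_powR; rewrite ?nnegrE ?mulr_ge0 ?(ltW s_gt0)//.
    exact: dotp_sphere_le1.
  rewrite indicE; case: (boolP (t \in D)) => tD.
    by rewrite mulr1 (le_trans a2)// lerDr ltW.
  rewrite mulr0 addr0 leNgt; apply: contra tD => tD.
  by apply/mem_set; split=> //; exact: ltW.
have : (Lambda1%:E <= cone_floor%:E * sg (@sphere R n) + Lambda2%:E * sg D)%E.
  apply: (le_trans L1); under eq_integral do rewrite EFinD (EFinM Lambda2).
  rewrite ge0_integralD//; last 3 first.
  - by move=> t _; rewrite lee_fin ltW.
  - by move=> t _; rewrite -EFinM lee_fin mulr_ge0// ltW.
  - by apply/measurable_EFinP; apply: measurable_funM.
  rewrite integral_cst// ge0_integralZl//; last 2 first.
  - by apply/measurable_EFinP.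
  - by rewrite lee_fin ltW.
  rewrite integral_indic// (_ : D `&` _ = D)//.
  by apply/seteqP; split=> t; [case|move=> Dt; split=> //; case: Dt].
have sgE B : sg B = (n%:R%:E * leb (cone B 1))%E by exact: sphere_measureE_cone.
rewrite !sgE.
have [v -> /andP[_ vle]] := ge0_le_EFin (measure_ge0 leb _) (lebesgue_cone1_le mS).
have [w -> _] := ge0_le_EFin (measure_ge0 leb _) (lebesgue_cone1_le measurable_D).
rewrite -!EFinM -EFinD !lee_fin => H.
have n0 : 0 < n%:R :> R by rewrite ltr0n.
rewrite /cone_mass ler_pdivrMr ?mulr_gt0//.
have : cone_floor * (n%:R * v) <= Lambda1 / 2.
  rewrite (_ : Lambda1 / 2 = cone_floor * (n%:R * 2 ^+ n)).
    by rewrite ler_pM2l// ler_pM2l.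
  rewrite /cone_floor; field.
  by rewrite expf_neq0//= gt_eqF.
by move=> ?; lra.
Qed.

(** The factor left after inserting r = (2b / [cone_mass])^(1/n) into b [cone_floor] r^(-(n+2s)) and
    taking out b^(-2s/n). *)
Definition tail_const : R :=
  cone_floor * (2 / cone_mass) `^ (- (1 + 2 * s / n%:R)).

Lemma tail_const_gt0 : 0 < tail_const.
Proof. by rewrite mulr_gt0// powR_gt0// divr_gt0. Qed.

(** The power of [b] is dictated by scaling: at distance r of order b^(1/n) the kernel is of order
    r^(-(n+2s)), and it is integrated over a set of measure at least b. *)
Lemma kernel_tail_ge (E : set 'rV[R]_n) (b : R) (x : 'rV[R]_n) :
  measurable E -> (leb E <= b%:E)%E -> 0 < b ->
  ((tail_const * b `^ (- (2 * s / n%:R)))%:E <=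
   \int[leb]_(y in [set y | ~ E (x + y)%R]) (kernel a y)%:E)%E.
Proof.
move=> mE Eb b0; have n0 : 0 < n%:R :> R by rewrite ltr0n.
have bm0 : 0 < 2 * b / cone_mass by rewrite divr_gt0// mulr_gt0.
(* The cone of radius r has measure at least 2b, so half of it avoids E - x. *)
pose r := (2 * b / cone_mass) `^ (n%:R^-1).
have r0 : 0 < r by rewrite powR_gt0.
have rn : r ^+ n = 2 * b / cone_mass.
  rewrite -powR_mulrn ?(ltW r0)// -powRrM mulVf ?gt_eqF// powRr1//.
  by rewrite ltW// divr_gt0// mulr_gt0.
pose Ex := (fun y : 'rV[R]_n => 1 *: y + x) @^-1` E.
have mEx : measurable Ex.
  by rewrite -[X in measurable X]setTI; exact: measurable_affine_rV.
have ExE y : Ex y = E (x + y) by rewrite /Ex /preimage/= scale1r addrC.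
have Exb : (leb Ex <= b%:E)%E.
  by have := lebesgue_rV_affine x (@ltr01 R) mE; rewrite expr1n mul1e => ->.
rewrite (_ : [set y | _] = ~` Ex); last first.
  by apply/seteqP; split=> y; rewrite /= ExE.
have mC := measurable_cone r measurable_D.
pose A := cone D r `\` Ex.
have mA : measurable A by exact: measurableD.
have Ab : (b%:E <= leb A)%E.
  have : (leb (cone D r) <= leb A + leb Ex)%E.
    apply: (@le_trans _ _ (leb (A `|` Ex))).
      apply: le_measure; rewrite ?inE//; first exact: measurableU.
      by move=> y Cy; have [Ey|Ey] := pselect (Ex y); [right|left].
    exact: measureU2.
  rewrite (lebesgue_cone r0 measurable_D) rn => H.
  have : ((2 * b)%:E <= leb A + b%:E)%E.
    apply: (@le_trans _ _ ((2 * b / cone_mass)%:E * leb (cone D 1)))%E.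
      have -> : ((2 * b)%:E = (2 * b / cone_mass)%:E * cone_mass%:E)%E.
        by rewrite -EFinM divfK// gt_eqF.
      rewrite lee_wpmul2l ?lebesgue_cone_ge// lee_fin divr_ge0//; last exact: ltW.
      by rewrite mulr_ge0// ltW.
    apply: (le_trans H); exact: leeD2l.
  case: (leb A) (measure_ge0 leb A) => [v _| _ _|//]; last by rewrite leey.
  by rewrite -EFinD !lee_fin; lra.
apply: (@le_trans _ _ (\int[leb]_(y in A) (kernel a y)%:E)%E); last first.
  apply: ge0_subset_integral => //; first exact: measurableC.
  - by apply/measurable_EFinP/measurable_funTS; exact: measurable_kernel.
  - by move=> y _; rewrite lee_fin kernel_ge0.
  - by move=> y [].
(* On the cone, [a] is at least [cone_floor] and |y| <= r, so [c] is a lower bound for the kernel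
   there. *)
pose c := cone_floor * r `^ (- (n%:R + 2 * s)).
have c0 : 0 <= c by rewrite mulr_ge0 ?powR_ge0// ltW.
apply: (@le_trans _ _ (\int[leb]_(y in A) c%:E)%E); last first.
  apply: ge0_le_integral => //.
  - by apply/measurable_EFinP/measurable_funTS; exact: measurable_kernel.
  - move=> y [[/andP[y0 yr] [_ ay]] _]; rewrite lee_fin /kernel /c powRN.
    apply: ler_pM => //; [exact: ltW|by rewrite invr_ge0 powR_ge0|].
    rewrite lef_pV2 ?posrE ?powR_gt0 ?bm0//.
    by apply: ge0_ler_powR; rewrite ?nnegrE ?(ltW exponent_gt0)//; exact: ltW.
rewrite (integral_cst leb mA c%:E); apply: (@le_trans _ _ (c%:E * b%:E)%E); last first.
  by rewrite lee_wpmul2l.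
rewrite -EFinM lee_fin /c /tail_const /r -powRrM.
rewrite (_ : n%:R^-1 * - (n%:R + 2 * s) = - (1 + 2 * s / n%:R)); last first.
  by field; rewrite gt_eqF.
rewrite -[leRHS]mulrA -[leLHS]mulrA ler_pM2l//.
rewrite (_ : 2 * b / cone_mass = 2 / cone_mass * b); last by ring.
rewrite [in leRHS]powRM ?(ltW b0)//; last by rewrite divr_ge0 ?ltW.
rewrite -[leRHS]mulrA ler_wpM2l ?powR_ge0//.
have {3}-> : b = b `^ 1 by rewrite powRr1// ltW.
rewrite -powRD; last by rewrite (gt_eqF b0) implybT.
by rewrite le_eqVlt; apply/orP; left; apply/eqP; congr (_ `^ _); ring.
Qed.

End kernel_tail.

(** * Lipschitz functions of u as test functions *)

Section Lnorm_monotone.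
Context d (T : measurableType d) (R : realType).
Variable mu : {measure set T -> \bar R}.

Lemma le_Lnorm (p : R) (f g : T -> R) : 0 < p ->
  measurable_fun setT f -> measurable_fun setT g ->
  (forall x, `|f x| <= `|g x|) ->
  ('N[mu]_p%:E[EFin \o f] <= 'N[mu]_p%:E[EFin \o g])%E.
Proof.
move=> p0 mf mg fg; rewrite unlock.
have I0 (h : T -> R) : (0 <= \int[mu]_x `|(EFin \o h) x| `^ p)%E.
  by apply: integral_ge0 => x _; exact: poweR_ge0.
have mI (h : T -> R) : measurable_fun setT h ->
    measurable_fun setT (fun x => (`|(EFin \o h) x| `^ p)%E).
  move=> mh; rewrite (_ : (fun _ => _) = EFin \o (fun x => `|h x| `^ p))//.
  by apply/measurable_EFinP/measurable_comp_powR/measurableT_comp.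
apply: gt0_ler_poweR; [by rewrite invr_ge0 ltW|by rewrite in_itv/= leey andbT I0..|].
apply: ge0_le_integral => //.
- by move=> x _; exact: poweR_ge0.
- exact: mI.
- exact: mI.
by move=> x _; rewrite lee_fin; apply: ge0_ler_powR; rewrite ?nnegrE// ltW.
Qed.

End Lnorm_monotone.

Section energy.
Context {R : realType} (n : nat) (s : R).
Local Notation leb := (@lebesgue_rV R n).
Implicit Types u : 'rV[R]_n -> R.

Lemma in_Lp_measurable Omega p (f : 'rV[R]_n -> R) :
  in_Lp Omega p f -> measurable_fun setT (f \_ Omega).
Proof. by move=> /sub_Lfun_mfun; rewrite inE. Qed.

Lemma in_Hs_measurable u : in_Hs s u -> measurable_fun setT u.
Proof. by move=> [/in_Lp_measurable]; rewrite patch_setT. Qed.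

Lemma measurable_sub_rV :
  measurable_fun setT (fun z : 'rV[R]_n * 'rV[R]_n => z.1 - z.2).
Proof.
apply: measurable_fun_coorP => i.
rewrite (_ : (fun _ => _) = (fun z : 'rV[R]_n * 'rV[R]_n => z.1 ord0 i - z.2 ord0 i)).
  apply: measurable_funB;
    exact: (@measurableT_comp _ _ _ _ _ _ (fun x : 'rV[R]_n => x ord0 i) _ _
    (measurable_coor i)).
by apply/funext => z; rewrite !mxE.
Qed.

Lemma measurable_add_rV :
  measurable_fun setT (fun z : 'rV[R]_n * 'rV[R]_n => z.1 + z.2).
Proof.
apply: measurable_fun_coorP => i.
rewrite (_ : (fun _ => _) = (fun z : 'rV[R]_n * 'rV[R]_n => z.1 ord0 i + z.2 ord0 i)).
  apply: measurable_funD;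
    exact: (@measurableT_comp _ _ _ _ _ _ (fun x : 'rV[R]_n => x ord0 i) _ _
    (measurable_coor i)).
by apply/funext => z; rewrite !mxE.
Qed.

(** Since phi 0 = 0, both |phi(u)| and the differences of phi(u) are at most [L] times those of u,
    so each half of the H^s condition is inherited. *)
Lemma in_Hs_lipschitz (phi : R -> R) (L : R) u :
  measurable_fun setT phi -> phi 0 = 0 ->
  (forall x y, `|phi x - phi y| <= L * `|x - y|) ->
  in_Hs s u -> in_Hs s (phi \o u).
Proof.
move=> mphi phi0 Lphi Hu; have mu := in_Hs_measurable Hu.
have [u2 uG] := Hu.
have mphiu : measurable_fun setT (phi \o u) by exact: measurableT_comp.
have L0 : 0 <= L by have := Lphi 1 0; rewrite subr0 normr1 mulr1; exact: le_trans.
split.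
  move: u2; rewrite /in_Lp !patch_setT => u2.
  have Lu : (L \o* u) \in Lfun leb 2%:E by apply: Lfun_scale; rewrite ?ler1n.
  rewrite inE; apply/andP; split; first by rewrite inE.
  rewrite inE /finite_norm/=.
  move: Lu; rewrite inE => /andP[_]; rewrite inE /finite_norm; apply: le_lt_trans.
  apply: le_Lnorm => //; first exact: measurable_funM.
  by move=> x /=; rewrite normrM (ger0_norm L0) mulrC;
    have := Lphi (u x) 0; rewrite phi0 !subr0.
pose G (w : 'rV[R]_n -> R) (z : 'rV[R]_n * 'rV[R]_n) : R :=
  `|w z.1 - w z.2| ^+ 2 / enorm (z.1 - z.2) `^ (n%:R + 2 * s).
have mG w : measurable_fun setT w -> measurable_fun setT (G w).
  move=> mw; apply: measurable_funM.
    apply: measurable_funX; apply: measurableT_comp => //.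
    by apply: measurable_funB; exact: measurableT_comp.
  rewrite (_ : (fun _ => _) = (fun z : 'rV[R]_n * 'rV[R]_n =>
      enorm (z.1 - z.2) `^ (- (n%:R + 2 * s)))).
    apply: measurable_comp_powR; apply: measurableT_comp; first exact: measurable_enorm.
    exact: measurable_sub_rV.
  by apply/funext => z; rewrite powRN.
have G0 w z : 0 <= G w z by rewrite divr_ge0 ?powR_ge0// exprn_ge0.
apply: (@le_lt_trans _ _ (\int[leb \x leb]_z ((L ^+ 2)%:E * (G u z)%:E))%E).
  apply: ge0_le_integral => //.
  - by move=> z _; rewrite lee_fin; exact: (G0 (phi \o u)).
  - by apply/measurable_EFinP; exact: (mG (phi \o u)).
  - by apply/measurable_EFinP; apply: measurable_funM => //; exact: mG.
  - move=> z _; rewrite -EFinM lee_fin /G mulrA ler_wpM2r ?invr_ge0 ?powR_ge0//.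
    by rewrite -exprMn; apply: lerXn2r; rewrite ?nnegrE ?mulr_ge0//; exact: Lphi.
rewrite ge0_integralZl//; last 3 first.
- by apply/measurable_EFinP; exact: mG.
- by move=> z _; rewrite lee_fin.
- by rewrite lee_fin exprn_ge0.
by rewrite lte_mul_pinfty// lee_fin exprn_ge0.
Qed.

End energy.

(** * The energy inequality *)

Section energy_estimate.
Context {R : realType} (n : nat) (s Lambda1 Lambda2 : R).
Hypotheses (n_gt0 : (0 < n)%N) (s_gt0 : 0 < s).
Hypotheses (Lambda1_gt0 : 0 < Lambda1) (Lambda2_gt0 : 0 < Lambda2).
Local Notation leb := (@lebesgue_rV R n).
Local Notation tail := (tail_const n s Lambda1 Lambda2).

Variables (Omega : set 'rV[R]_n) (a g u : 'rV[R]_n -> R).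
Hypothesis adm : admissible_kernel s Lambda1 Lambda2 a.
Hypothesis g2 : in_Lp Omega 2%:E g.
Hypothesis usol : weak_solution s a Omega g u.

Variables (phi : R -> R) (L : R).
Hypothesis mphi : measurable_fun setT phi.
Hypothesis phi_odd : forall t, phi (- t) = - phi t.
Hypothesis phi_nd : {homo phi : x y / x <= y}.
Hypothesis phi_lip : forall x y, `|phi x - phi y| <= L * `|x - y|.

Let phi0 : phi 0 = 0.
Proof. by have := phi_odd 0; rewrite oppr0 => ?; lra. Qed.

Let mu : measurable_fun setT u.
Proof. by case: usol => /in_Hs_measurable. Qed.

Let F (z : 'rV[R]_n * 'rV[R]_n) : R :=
  (u z.1 - u (z.1 + z.2)) * (phi (u z.1) - phi (u (z.1 + z.2))) * kernel s a z.2.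

(** Monotonicity of [phi] gives both differences the same sign; nonnegativity permits Tonelli and
    dropping part of the y-domain. *)
Let F_ge0 z : 0 <= F z.
Proof.
rewrite mulr_ge0 ?(kernel_ge0 n_gt0 s_gt0 adm)//.
have [le_u|/ltW le_u] := leP (u z.1) (u (z.1 + z.2)).
  by rewrite -mulrNN !opprB mulr_ge0 ?subr_ge0// phi_nd.
by rewrite mulr_ge0 ?subr_ge0// phi_nd.
Qed.

Let mF : measurable_fun setT F.
Proof.
have mu1 : measurable_fun setT (fun z : 'rV[R]_n * 'rV[R]_n => u z.1).
  exact: measurableT_comp.
have mu2 : measurable_fun setT (fun z : 'rV[R]_n * 'rV[R]_n => u (z.1 + z.2)).
  by apply: measurableT_comp => //; exact: measurable_add_rV.
apply: measurable_funM; last first.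
  apply: (measurableT_comp (measurable_kernel n_gt0 s_gt0 adm)) => //.
apply: measurable_funM; first exact: measurable_funB.
by apply: measurable_funB; exact: measurableT_comp.
Qed.

Let superlevel (k : R) : set 'rV[R]_n := [set x | k < `|u x|].

(** Only those y with |u(x+y)| <= k are kept. There u(x) and u(x+y) differ by at least h - k and
    their images under [phi] by at least phi h - phi k, and the remaining integral of the kernel is
    bounded by [kernel_tail_ge]. *)
Let F_inner_ge (x : 'rV[R]_n) (h k b : R) : 0 <= k -> k <= h -> h <= `|u x| -> 0 < b ->
  (leb (superlevel k) <= b%:E)%E ->
  (((h - k) * (phi h - phi k) * (tail * b `^ (- (2 * s / n%:R))))%:E <=
   \int[leb]_y (F (x, y))%:E)%E.
Proof.
move=> k0 kh hu b0 levb.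
have mlev : measurable (superlevel k).
  rewrite (_ : superlevel k = (Num.norm \o u) @^-1` `]k, +oo[).
    by rewrite -[X in measurable X]setTI; apply: measurableT_comp.
  by apply/seteqP; split=> y; rewrite /superlevel/= in_itv/= andbT.
have hk0 : 0 <= (h - k) * (phi h - phi k).
  by rewrite mulr_ge0 ?subr_ge0// phi_nd.
have tail_le := kernel_tail_ge n_gt0 s_gt0 Lambda1_gt0 Lambda2_gt0 adm x mlev levb b0.
pose B : set 'rV[R]_n := [set y | ~ superlevel k (x + y)].
have mB : measurable B.
  rewrite (_ : B = ~` ((fun y => 1 *: y + x) @^-1` superlevel k)).
    by apply: measurableC; rewrite -[X in measurable X]setTI; exact: measurable_affine_rV.
  by apply/seteqP; split=> y; rewrite /B/= scale1r addrC.
have mFx : measurable_fun setT (fun y => F (x, y)).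
  by apply: (measurableT_comp mF).
have mK := measurable_kernel n_gt0 s_gt0 adm.
have K0 y : 0 <= kernel s a y by exact: (kernel_ge0 n_gt0 s_gt0 adm).
apply: (@le_trans _ _ (\int[leb]_(y in B) (F (x, y))%:E)%E); last first.
  apply: ge0_subset_integral => //; first exact/measurable_EFinP.
  by move=> y _; rewrite lee_fin.
apply: (@le_trans _ _ (\int[leb]_(y in B)
    (((h - k) * (phi h - phi k))%:E * (kernel s a y)%:E))%E); last first.
  apply: ge0_le_integral => //.
  - by move=> y _; rewrite -EFinM lee_fin mulr_ge0.
  - by apply/measurable_EFinP/measurable_funTS; apply: measurable_funM.
  - by apply/measurable_EFinP/measurable_funTS.
  move=> y; rewrite /B /superlevel/= => /negP; rewrite -leNgt => uk.
  rewrite -EFinM lee_fin /F/= ler_wpM2r//.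
  have [ux|ux] := leP 0 (u x).
    move: hu; rewrite ger0_norm// => hu.
    have uyk : u (x + y) <= k by exact: le_trans (ler_norm _) uk.
    by apply: ler_pM; rewrite ?subr_ge0 ?phi_nd// lerB ?phi_nd.
  move: hu; rewrite ltr0_norm// => hu.
  have uyk : - k <= u (x + y) by move: uk; rewrite ler_norml => /andP[].
  (* For u(x) < 0 both differences change sign, and oddness of [phi] reduces to the levels -h and
     -k. *)
  rewrite -[leRHS]mulrNN !opprB.
  have hu' : u x <= - h by lra.
  have := phi_nd hu'; have := phi_nd uyk; rewrite !phi_odd => p1 p2.
  by apply: ler_pM; rewrite ?subr_ge0 ?phi_nd//; lra.
rewrite ge0_integralZl//; last 2 first.
- by apply/measurable_EFinP/measurable_funTS.
- by move=> y _; rewrite lee_fin.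
by rewrite EFinM lee_wpmul2l// lee_fin.
Qed.

(** The weak formulation is tested with phi(u). The levels [h], [k] and the bound [b] may vary with
    x: the inner lower bound holds at each x separately, and only its minorant [H] is integrated. *)
Lemma energy_estimate (H : 'rV[R]_n -> R) : measurable_fun setT H ->
  (forall x, 0 <= H x) ->
  (forall x : 'rV[R]_n, H x = 0 \/ exists h k b : R,
    [/\ 0 <= k <= h, h <= `|u x|, 0 < b,
        (leb [set y | (k < `|u y|)%R] <= b%:E)%E &
        H x <= (h - k) * (phi h - phi k) * (tail * b `^ (- (2 * s / n%:R)))]) ->
  (\int[leb]_x (H x)%:E <=
   \int[leb]_x (`|(g \_ Omega) x| * `|phi (u x)|)%:E)%E.
Proof.
move=> mH H0 HF.
have [Hu u0 weak] := usol.
have Hv := in_Hs_lipschitz mphi phi0 phi_lip Hu.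
have v0 : vanishes_outside Omega (phi \o u).
  by move: u0; apply: filterS => x ux /ux /= ->.
have mg := in_Lp_measurable g2.
have mphiu : measurable_fun setT (phi \o u) by exact: measurableT_comp.
have := weak _ Hv v0; rewrite fubini_tonelli1; last 2 first.
- exact/measurable_EFinP.
- by move=> z; rewrite lee_fin; exact: F_ge0.
move=> E.
apply: (@le_trans _ _ (\int[leb]_x \int[leb]_y (F (x, y))%:E)%E).
  apply: ge0_le_integral => //.
  - by move=> x _; rewrite lee_fin.
  - exact/measurable_EFinP.
  - apply: (@measurable_fun_fubini_tonelli_F _ _ _ _ _ leb (EFin \o F)).
      exact/measurable_EFinP.
    by move=> z; rewrite lee_fin.
  move=> x _; have [->|[h [k [b [/andP[k0 kh] hu b0 levb Hle]]]]] := HF x.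
    by apply: integral_ge0 => y _; rewrite lee_fin.
  by apply: (le_trans _ (F_inner_ge k0 kh hu b0 levb)); rewrite lee_fin.
rewrite [leLHS]E integral_mkcond.
rewrite (_ : _ \_ _ = fun x => ((g \_ Omega) x * phi (u x))%:E); last first.
  by apply/funext => x; rewrite !patchE; case: ifPn => //; rewrite mul0r.
apply: (le_trans (lee_abs _)); apply: le_trans (le_abse_integral _ _ _) _ => //.
  by apply/measurable_EFinP; exact: measurable_funM.
by under eq_integral do rewrite /= normrM.
Qed.

End energy_estimate.

(** * Hoelder's inequality and truncated integrals *)

Section measure_tools.
Context d (T : measurableType d) (R : realType).
Variable mu : {measure set T -> \bar R}.

Lemma hoelder_integral (p N J : R) (f w : T -> R) : 1 < p ->
  measurable_fun setT f -> measurable_fun setT w ->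
  0 <= N -> 0 <= J -> ('N[mu]_p%:E[EFin \o f] <= N%:E)%E ->
  (\int[mu]_x (`|w x| `^ (p / (p - 1)))%:E <= J%:E)%E ->
  (\int[mu]_x (`|f x| * `|w x|)%:E <= (N * J `^ (1 - p^-1))%:E)%E.
Proof.
move=> p1 mf mw N0 J0 fN wJ.
have p0 : 0 < p by lra.
have q0 : 0 < p / (p - 1) by rewrite divr_gt0// subr_gt0.
have pq : p^-1 + (p / (p - 1))^-1 = 1.
  by field; rewrite (gt_eqF p0) subr_eq0 (gt_eqF p1).
have := hoelder mu mf mw p0 q0 pq; rewrite Lnorm1.
under eq_integral do rewrite /= normrM.
move=> /le_trans; apply; rewrite (EFinM N); apply: lee_pmul => //; rewrite ?Lnorm_ge0//.
rewrite unlock (_ : 1 - p^-1 = (p / (p - 1))^-1); last by lra.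
rewrite -poweR_EFin; apply: gt0_ler_poweR.
- by rewrite invr_ge0 ltW.
- by rewrite in_itv/= leey andbT; apply: integral_ge0 => x _; rewrite lee_fin powR_ge0.
- by rewrite in_itv/= leey andbT lee_fin.
by apply: le_trans wJ; under eq_integral do rewrite poweR_EFin.
Qed.

Lemma integral_indic_le_Lnorm (p N b : R) (f : T -> R) (E : set T) : 1 <= p ->
  measurable_fun setT f -> measurable E ->
  0 <= N -> 0 <= b -> ('N[mu]_p%:E[EFin \o f] <= N%:E)%E ->
  (mu E <= b%:E)%E ->
  (\int[mu]_x (`|f x| * \1_E x)%:E <= (N * b `^ (1 - p^-1))%:E)%E.
Proof.
move=> p_ge1 mf mE N0 b0 fN Eb.
(* For p = 1 the conjugate exponent is infinite; the claimed factor is then [b] to the power 0,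
   which is 1 even for b = 0. *)
have [p1|p1] := leP p 1.
  have {p1} p1 : p = 1 by apply/eqP; rewrite eq_le p1.
  move: fN; rewrite p1 => fN; rewrite invr1 subrr powRr0 mulr1.
  apply: (le_trans _ fN); rewrite Lnorm1.
  apply: ge0_le_integral => //.
  - apply/measurable_EFinP; apply: measurable_funM => //.
    exact: measurableT_comp.
  - by apply: measurableT_comp => //; apply/measurable_EFinP.
  by move=> x _; rewrite lee_fin ler_piMr.
have -> : (\int[mu]_x (`|f x| * \1_E x)%:E =
    \int[mu]_x (`|f x| * `|\1_E x|)%:E)%E.
  by apply: eq_integral => x _; rewrite (@ger0_norm _ (\1_E x)).
apply: hoelder_integral => //.
apply: le_trans Eb; rewrite -[X in mu X]setIT -integral_indic// le_eqVlt.
apply/orP; left; apply/eqP/eq_integral => x _; rewrite indicE.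
case: (x \in E); first by rewrite normr1 powR1.
by rewrite normr0 powR0// gt_eqF// divr_gt0 ?subr_gt0//; lra.
Qed.

(** Monotone convergence: at each point the truncations at the levels j c are eventually equal to
    |f|. *)
Lemma integral_powR_le_trunc (q c B : R) (f : T -> R) : 0 < q -> 0 < c ->
  measurable_fun setT f ->
  (forall j : nat, (\int[mu]_x (Num.min `|f x| (j%:R * c) `^ q)%:E <= B%:E)%E) ->
  (\int[mu]_x (`|f x| `^ q)%:E <= B%:E)%E.
Proof.
move=> q0 c0 mf fB.
pose h (j : nat) (x : T) : \bar R := (Num.min `|f x| (j%:R * c) `^ q)%:E.
have hE x : (`|f x| `^ q)%:E = limn (h ^~ x).
  apply/esym/cvg_lim => //; apply: cvg_near_cst.
  near=> j; rewrite /h min_l//.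
  rewrite -ler_pdivrMr//; near: j; exact: nbhs_infty_ger.
under eq_integral do rewrite hE.
rewrite monotone_convergence//.
- apply: lime_le; last by apply: nearW => j; exact: fB.
  apply: ereal_nondecreasing_is_cvgn => i j ij.
  apply: ge0_le_integral => //.
  + by move=> x _; rewrite lee_fin powR_ge0.
  + apply/measurable_EFinP/measurable_comp_powR; apply: measurable_minr => //.
    exact: measurableT_comp.
  + apply/measurable_EFinP/measurable_comp_powR; apply: measurable_minr => //.
    exact: measurableT_comp.
  + move=> x _; rewrite lee_fin; apply: ge0_ler_powR; rewrite ?nnegrE ?(ltW q0)//.
    * by rewrite le_min normr_ge0 mulr_ge0// ltW.
    * by rewrite le_min normr_ge0 mulr_ge0// ltW.
    * by rewrite le_min ge_min lexx/= ge_min ler_pM2r// ler_nat ij orbT.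
- move=> j; apply/measurable_EFinP/measurable_comp_powR; apply: measurable_minr => //.
  exact: measurableT_comp.
- by move=> j x _; rewrite lee_fin powR_ge0.
- move=> x _ i j ij; rewrite lee_fin; apply: ge0_ler_powR; rewrite ?nnegrE ?(ltW q0)//.
  + by rewrite le_min normr_ge0 mulr_ge0// ltW.
  + by rewrite le_min normr_ge0 mulr_ge0// ltW.
  + by rewrite le_min ge_min lexx/= ge_min ler_pM2r// ler_nat ij orbT.
Unshelve. all: by end_near. Qed.

End measure_tools.

(** Lets a positive real [N] stand for the norm of g. Taking N = y + e / C for every e > 0 also
    covers y = 0. *)
Lemma lee_scale_of_lt (R : realType) (C : R) (x y : \bar R) : 0 < C ->
  (0 <= y)%E -> (y < +oo)%E ->
  (forall N, 0 < N -> (y <= N%:E)%E -> (x <= (C * N)%:E)%E) -> (x <= C%:E * y)%E.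
Proof.
move=> C0; case: y => [r| |]// r0 _ H; apply/lee_addgt0Pr => e e0.
rewrite lee_fin in r0.
have := H (r + e / C); rewrite lee_fin mulrDr (mulrC C (e / C)) divfK ?gt_eqF//.
by rewrite EFinD EFinM; apply; rewrite ?lerDl ?ltr_wpDl// ?ltW// divr_gt0.
Qed.

(** Used with D = h - k, T the tail constant, X = b^(1-1/p), Y = b^(2s/n) and m the measure of the
    higher superlevel set. *)
Lemma decay_of_energy (R : realFieldType) (m N X Y D T : R) :
  0 < D -> 0 < T -> 0 < Y -> D * D * (T * Y^-1) * m <= D * (N * X) ->
  m <= N / T / D * (X * Y).
Proof.
move=> D0 T0 Y0; rewrite -!mulrA ler_pM2l// => H.
have -> : N * (T^-1 * (D^-1 * (X * Y))) = (N * X * Y) / (D * T).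
  by field; rewrite !gt_eqF.
rewrite ler_pdivlMr ?mulr_gt0// -ler_pdivrMr//.
by rewrite (_ : _ / Y = D * (T * (Y^-1 * m))); last by ring.
Qed.

(** * Truncation between two levels and decay of superlevel sets *)

Definition ramp (R : realType) (c k t : R) : R := Num.min c (Num.max 0 (t - k)).

Section ramp.
Context {R : realType} (c k : R).
Hypothesis c0 : 0 <= c.

Lemma measurable_ramp : measurable_fun setT (ramp c k).
Proof.
by apply: measurable_minr => //; apply: measurable_maxr => //; exact: measurable_funB.
Qed.

Lemma ramp_nd : {homo ramp c k : x y / x <= y}.
Proof.
move=> x y xy; rewrite /ramp le_min; apply/andP; split; first by rewrite ge_min lexx.
rewrite ge_min; apply/orP; right; rewrite ge_max !le_max lexx/=.
by rewrite lerD2r xy orbT.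
Qed.

Lemma ramp_le t : ramp c k t <= c.
Proof. by rewrite /ramp ge_min lexx. Qed.

Lemma ramp_lipschitz x y : `|ramp c k x - ramp c k y| <= 1 * `|x - y|.
Proof.
wlog xy : x y / y <= x.
  move=> W; have [/W//|/ltW/W] := leP y x.
  by rewrite distrC (distrC x y).
rewrite mul1r !ger0_norm ?subr_ge0 ?ramp_nd// lerBlDl -lerBlDr.
rewrite [leRHS]/ramp le_min; apply/andP; split.
  by rewrite lerBlDr (le_trans (ramp_le x))// lerDl subr_ge0.
rewrite lerBlDr; apply: (@le_trans _ _ (Num.max 0 (x - k))).
  by rewrite /ramp ge_min lexx orbT.
rewrite ge_max; apply/andP; split.
  by rewrite addr_ge0 ?subr_ge0// le_max lexx.
rewrite -lerBlDr (_ : _ - _ = y - k); last by ring.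
by rewrite le_max lexx orbT.
Qed.

Lemma ramp_eq0 t : t <= k -> ramp c k t = 0.
Proof. by move=> tk; rewrite /ramp max_l ?min_r// subr_le0. Qed.

Lemma ramp_top t : c + k <= t -> ramp c k t = c.
Proof.
move=> ht; have ct : c <= t - k by rewrite lerBrDr.
by rewrite /ramp max_r ?min_l// (le_trans c0).
Qed.

End ramp.

Section energy_positive.
Context {R : realType} (n : nat) (s Lambda1 Lambda2 : R).
Hypotheses (n_gt0 : (0 < n)%N) (s_gt0 : 0 < s).
Hypotheses (Lambda1_gt0 : 0 < Lambda1) (Lambda2_gt0 : 0 < Lambda2).
Local Notation leb := (@lebesgue_rV R n).
Local Notation tail := (tail_const n s Lambda1 Lambda2).

Variables (Omega : set 'rV[R]_n) (a g u : 'rV[R]_n -> R).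
Hypothesis adm : admissible_kernel s Lambda1 Lambda2 a.
Hypothesis g2 : in_Lp Omega 2%:E g.
Hypothesis usol : weak_solution s a Omega g u.

Lemma weak_solution_measurable : measurable_fun setT u.
Proof. by case: usol => /in_Hs_measurable. Qed.

(** The cut-offs used below are functions of |u| vanishing on the negative half-line, whereas
    [energy_estimate] asks for an odd function of u. *)
Lemma energy_estimate_abs (psi : R -> R) (L : R) (H : 'rV[R]_n -> R) :
  measurable_fun setT psi ->
  {homo psi : x y / x <= y} ->
  (forall t, t <= 0 -> psi t = 0) ->
  (forall x y, `|psi x - psi y| <= L * `|x - y|) ->
  measurable_fun setT H -> (forall x, 0 <= H x) ->
  (forall x : 'rV[R]_n, H x = 0 \/ exists h k b : R,
    [/\ 0 <= k <= h, h <= `|u x|, 0 < b,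
        (leb [set y | (k < `|u y|)%R] <= b%:E)%E &
        H x <= (h - k) * (psi h - psi k) * (tail * b `^ (- (2 * s / n%:R)))]) ->
  (\int[leb]_x (H x)%:E <=
   \int[leb]_x (`|(g \_ Omega) x| * psi `|u x|)%:E)%E.
Proof.
move=> mpsi psi_nd psi_le0 psi_lip mH H0 HF.
(* The odd extension of psi treats both signs of u at once. *)
pose phi t := psi t - psi (- t).
have psi0 t : 0 <= psi t.
  have [/psi_le0->//|t0] := leP t 0.
  by rewrite -(psi_le0 0)//; apply/psi_nd/ltW.
have phiE t : 0 <= t -> phi t = psi t.
  by move=> t0; rewrite /phi [psi (- t)]psi_le0 ?subr0// oppr_le0.
have -> : (\int[leb]_x (`|(g \_ Omega) x| * psi `|u x|)%:E =
    \int[leb]_x (`|(g \_ Omega) x| * `|phi (u x)|)%:E)%E.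
  apply: eq_integral => x _; congr (_ * _)%:E.
  have [ux|ux] := leP 0 (u x); first by rewrite phiE// [RHS]ger0_norm// ger0_norm.
  rewrite /phi (psi_le0 (u x)) ?(ltW ux)// add0r normrN [RHS]ger0_norm//.
  by rewrite ltr0_norm.
apply: (energy_estimate n_gt0 s_gt0 Lambda1_gt0 Lambda2_gt0 adm g2 usol
  (phi := phi) (L := L *+ 2)) => //.
- by apply: measurable_funB => //; apply: measurableT_comp => //.
- by move=> t; rewrite /phi opprK opprB.
- by move=> x y xy; apply: lerB; apply: psi_nd => //; rewrite lerN2.
- move=> x y; rewrite /phi (_ : _ - _ = (psi x - psi y) + - (psi (- x) - psi (- y))).
    apply: (le_trans (ler_normD _ _)); rewrite normrN mulrnAl mulr2n.
    by apply: lerD => //; apply: (le_trans (psi_lip _ _)); rewrite -opprD normrN.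
  by ring.
move=> x; have [->|[h [k [b [kh hu b0 ub Hle]]]]] := HF x; [by left|right].
exists h, k, b; split => //; have /andP[k0 kh'] := kh.
by rewrite !phiE// (le_trans k0).
Qed.

Variables (p N : R).
Hypotheses (p_ge1 : 1 <= p) (N_ge0 : 0 <= N).
Hypothesis gp : in_Lp Omega p%:E g.
Hypothesis gN : (Lp_norm Omega p%:E g <= N%:E)%E.

Lemma measurable_superlevel k : measurable [set x | k < `|u x|].
Proof.
rewrite (_ : mkset _ = (Num.norm \o u) @^-1` `]k, +oo[).
  rewrite -[X in measurable X]setTI; apply: measurableT_comp => //.
  exact: weak_solution_measurable.
by apply/seteqP; split=> y; rewrite /= in_itv/= andbT.
Qed.

(** With [psi] rising from 0 at k to h - k at h, the energy is at least [c] times the measure of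
    {|u| > h}. On the other side [psi] is at most h - k and vanishes off {|u| > k}, so Hoelder's
    inequality bounds it by (h - k) N b^(1-1/p). *)
Lemma superlevel_decay (h k b : R) : 0 <= k -> k < h -> 0 < b ->
  (leb [set x | (k < `|u x|)%R] <= b%:E)%E ->
  (leb [set x | (h < `|u x|)%R] <=
   (N / tail / (h - k) * b `^ (1 - p^-1 + 2 * s / n%:R))%:E)%E.
Proof.
move=> k0 kh b0 ub.
have hk0 : 0 < h - k by rewrite subr_gt0.
have mg := in_Lp_measurable gp.
have mh := measurable_superlevel h; have mk := measurable_superlevel k.
pose psi := ramp (h - k) k.
pose c := (h - k) * (h - k) * (tail * b `^ (- (2 * s / n%:R))).
have tail0 := tail_const_gt0 s n_gt0 Lambda1_gt0 Lambda2_gt0.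
have c0 : 0 < c.
  by apply: mulr_gt0; [exact: mulr_gt0|apply: mulr_gt0; [exact: tail0|exact: powR_gt0]].
pose H x := c * \1_[set x | (h < `|u x|)%R] x.
have hk0' := ltW hk0.
have mpsi : measurable_fun setT psi by exact: measurable_ramp.
have psi_nd : {homo psi : x y / x <= y} by exact: ramp_nd.
have psi_le0 t : t <= 0 -> psi t = 0.
  by move=> t0; apply: ramp_eq0 => //; exact: le_trans k0.
have psi_lip x y : `|psi x - psi y| <= 1 * `|x - y| by exact: ramp_lipschitz.
have mH : measurable_fun setT H by apply: measurable_funM.
have H0 x : 0 <= H x by rewrite mulr_ge0// ltW.
have psih : psi h = h - k by apply: ramp_top => //; rewrite subrK.
have psik : psi k = 0 by exact: ramp_eq0.
have : (\int[leb]_x (H x)%:E <= \int[leb]_x (`|(g \_ Omega) x| * psi `|u x|)%:E)%E.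
  apply: (energy_estimate_abs mpsi psi_nd psi_le0 psi_lip mH H0) => x.
  rewrite /H indicE; case: (boolP (x \in _)) => [/set_mem/= hu|_].
    right; exists h, k, b; split => //; first by rewrite k0 ltW.
      exact: ltW.
    by rewrite mulr1 psih psik subr0.
  by left; rewrite mulr0.
have -> : (\int[leb]_x (H x)%:E = c%:E * leb [set x | (h < `|u x|)%R])%E.
  under eq_integral do rewrite EFinM.
  rewrite ge0_integralZl//; last 2 first.
  - by apply/measurable_EFinP.
  - by rewrite lee_fin ltW.
  by rewrite integral_indic// setIT.
move=> Hmain.
have : (c%:E * leb [set x | (h < `|u x|)%R] <= ((h - k) * (N * b `^ (1 - p^-1)))%:E)%E.
  apply: (le_trans Hmain).
  have := integral_indic_le_Lnorm p_ge1 mg mk N_ge0 (ltW b0) gN ub.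
  rewrite -(@lee_pmul2l _ (h - k)%:E)// => /(le_trans _) ; apply.
  rewrite -ge0_integralZl//; last first.
    by apply/measurable_EFinP; apply: measurable_funM => //; exact: measurableT_comp.
  apply: ge0_le_integral => //.
  - move=> x _; rewrite lee_fin mulr_ge0// -(psi_le0 0)//; exact: psi_nd.
  - apply/measurable_EFinP; apply: measurable_funM; first exact: measurableT_comp.
    apply: measurableT_comp => //; apply: measurableT_comp => //.
    exact: weak_solution_measurable.
  - apply/measurable_EFinP; apply: measurable_funM => //.
    by apply: measurable_funM => //; exact: measurableT_comp.
  move=> x _; rewrite -EFinM lee_fin mulrCA ler_wpM2l// indicE.
  case: (boolP (x \in _)) => [_|/negP xk]; first by rewrite mulr1 ramp_le.
  rewrite mulr0 /psi ramp_eq0// leNgt.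
  by apply/negP => ?; apply: xk; rewrite inE.
(* An infinite measure would contradict the finite upper bound, as c > 0. *)
case: (leb _) (measure_ge0 leb [set x | (h < `|u x|)%R]) => [m _| _| _].
  rewrite -EFinM !lee_fin /c => H1.
  rewrite powRD; last by rewrite (gt_eqF b0) implybT.
  apply: decay_of_energy => //; last by rewrite -powRN.
  exact: powR_gt0.
  by rewrite gt0_muley ?lte_fin// leye_eq => /eqP.
by rewrite leNye.
Qed.

End energy_positive.

(** * Iteration over levels *)

Lemma geometric_le0 (R : realType) (V q v : R) : 0 <= q < 1 ->
  (forall j, v <= V * q ^+ j) -> v <= 0.
Proof.
move=> /andP[q0 q1] H; rewrite leNgt; apply/negP => v0.
have /(cvg_geometric V) : `|q| < 1 by rewrite ger0_norm.
move=> /cvgr_lt /(_ _ v0) [j _ /(_ j (leqnn j))] /=.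
by rewrite ltNge H.
Qed.

(** Along the levels d (1 - 2^-j), which increase to d, [m] is at most V q^j by induction, and q < 1
    forces m(d) = 0. *)
Lemma stampacchia (R : realType) (m : R -> \bar R) (A V theta : R) :
  0 < A -> 0 < V -> 0 < theta ->
  (forall k, (0 <= m k)%E) -> {homo m : x y / x <= y >-> (y <= x)%E} ->
  (m 0%R <= V%:E)%E ->
  (forall h k b, 0 <= k -> k < h -> 0 < b -> (m k <= b%:E)%E ->
     (m h <= (A / (h - k) * b `^ (1 + theta))%:E)%E) ->
  m (A * (2 * V `^ theta * 2 `^ theta^-1)) = 0%E.
Proof.
move=> A0 V0 t0 m0 mnd mV mdecay.
(* The choice makes q^theta = 1/2, so the superlinear gain offsets the halving of the gaps; the
   value of [d] then closes the induction with equality. *)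
pose q : R := 2 `^ (- theta^-1).
have q0 : 0 < q by rewrite powR_gt0.
have q1 : q < 1.
  rewrite /q powRN invf_lt1 ?powR_gt0//.
  apply: (@le_lt_trans _ _ (1 `^ theta^-1)); first by rewrite powR1.
  by apply: gt0_ltr_powR; rewrite ?nnegrE ?invr_gt0// ltr1n.
have qV : 2 `^ theta^-1 = q^-1 by rewrite /q powRN invrK.
have qt : q `^ theta = 2^-1.
  by rewrite /q -powRrM mulNr mulVf ?gt_eqF// powR_inv1.
rewrite qV; set d := A * _.
have Vt0 : 0 < V `^ theta by rewrite powR_gt0.
have d0 : 0 < d by rewrite /d !mulr_gt0// invr_gt0.
pose k j : R := d * (1 - 2^-1 ^+ j).
have half j : 0 < 2^-1 ^+ j :> R by rewrite exprn_gt0.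
have k0 j : 0 <= k j.
  by rewrite mulr_ge0 ?(ltW d0)// subr_ge0 exprn_ile1// invf_le1// ler1n.
have kd j : k j <= d.
  by rewrite /k ler_piMr ?(ltW d0)// gerBl ltW.
have mk j : (m (k j) <= (V * q ^+ j)%:E)%E.
  elim: j => [|j IH]; first by rewrite /k !expr0 subrr mulr0 mulr1.
  have kk : k j.+1 - k j = d * (2^-1 ^+ j / 2).
    by rewrite /k exprS; field.
  have kS : k j < k j.+1.
    by rewrite -subr_gt0 kk mulr_gt0// divr_gt0.
  have b0 : 0 < V * q ^+ j by rewrite mulr_gt0// exprn_gt0.
  apply: (le_trans (mdecay _ _ _ (k0 j) kS b0 IH)).
  rewrite lee_fin kk powRD; last by rewrite (gt_eqF b0) implybT.
  rewrite powRr1 ?(ltW b0)// [X in _ * (_ * X)]powRM ?(ltW V0) ?exprn_ge0 ?(ltW q0)//.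
  have -> : (q ^+ j) `^ theta = 2^-1 ^+ j.
    by rewrite -powR_mulrn ?(ltW q0)// powRAC qt powR_mulrn.
  rewrite le_eqVlt; apply/orP; left; apply/eqP.
  rewrite /d exprS; field.
  by rewrite (gt_eqF A0) (gt_eqF (half j)) (gt_eqF Vt0) (gt_eqF q0).
have md j : (m d <= (V * q ^+ j)%:E)%E := le_trans (mnd _ _ (kd j)) (mk j).
have [v vE /andP[v0 _]] := ge0_le_EFin (m0 d) (md 0).
rewrite vE; congr EFin; apply/eqP; rewrite eq_le v0 andbT.
apply: (@geometric_le0 _ V q); first by rewrite (ltW q0).
by move=> j; rewrite -lee_fin -vE.
Qed.

(** Without a superlinear gain the levels are equally spaced, and each step of length A K yields a
    factor 1 / K. *)
Lemma geometric_decay (R : realType) (m : R -> \bar R) (A V K : R) :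
  0 < A -> 0 < V -> 1 < K -> (m 0%R <= V%:E)%E ->
  (forall h k b, 0 <= k -> k < h -> 0 < b -> (m k <= b%:E)%E ->
     (m h <= (A / (h - k) * b)%:E)%E) ->
  forall j, (m (j%:R * (A * K))%R <= (V * K^-1 ^+ j)%:E)%E.
Proof.
move=> A0 V0 K1 mV mdecay.
have K0 : 0 < K by lra.
elim=> [|j IH]; first by rewrite mul0r expr0 mulr1.
have b0 : 0 < V * K^-1 ^+ j by rewrite mulr_gt0// exprn_gt0// invr_gt0.
have k0 : 0 <= j%:R * (A * K) by rewrite !mulr_ge0// ltW.
have kE : j.+1%:R * (A * K) - j%:R * (A * K) = A * K.
  by rewrite -natr1; ring.
have kS : j%:R * (A * K) < j.+1%:R * (A * K).
  by rewrite -subr_gt0 kE mulr_gt0.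
apply: (le_trans (mdecay _ _ _ k0 kS b0 IH)); rewrite kE lee_fin exprS.
rewrite le_eqVlt; apply/orP; left; apply/eqP; field.
by rewrite (gt_eqF A0) (gt_eqF K0).
Qed.

Section layers.
Context d (T : measurableType d) (R : realType).
Variable mu : {measure set T -> \bar R}.

(** Raising the truncation from j c to (j+1) c adds at most ((j+1) c)^q on {|f| > j c}. Since
    (j+1)^q <= 2^(jq), the decay rate 2^(-(q+1)) leaves an increment of at most c^q V 2^-j. *)
Lemma integral_powR_le_of_decay (f : T -> R) (c V q : R) :
  measurable_fun setT f -> 0 < c -> 0 < V -> 0 < q ->
  (forall j : nat, (mu [set x | (j%:R * c < `|f x|)%R] <=
     (V * (2 `^ (q + 1))^-1 ^+ j)%:E)%E) ->
  (\int[mu]_x (`|f x| `^ q)%:E <= (c `^ q * V * 2)%:E)%E.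
Proof.
move=> mf c0 V0 q0 fdecay.
have mset j : measurable [set x | j%:R * c < `|f x|].
  rewrite (_ : mkset _ = (Num.norm \o f) @^-1` `]j%:R * c, +oo[).
    by rewrite -[X in measurable X]setTI; apply: measurableT_comp.
  by apply/seteqP; split=> y; rewrite /= in_itv/= andbT.
pose w j x := Num.min `|f x| (j%:R * c).
have w0 j x : 0 <= w j x by rewrite le_min normr_ge0 mulr_ge0// ltW.
have mw j : measurable_fun setT (fun x => w j x `^ q).
  by apply/measurable_comp_powR/measurable_minr => //; exact: measurableT_comp.
have cq0 : 0 < c `^ q by rewrite powR_gt0.
apply: (integral_powR_le_trunc q0 c0 mf) => j.
(* The bracket is the sum of 2^-i over i < j, which makes the induction on [j] exact. *)
apply: (@le_trans _ _ (c `^ q * V * (2 - 2 * 2^-1 ^+ j))%:E); last first.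
  by rewrite lee_fin ler_pM2l ?mulr_gt0// gerBl mulr_ge0.
elim: j => [|j IH].
  rewrite expr0 mulr1 subrr mulr0 (_ : (fun x => _) = cst 0%E) ?integral0//.
  apply/funext => x; rewrite mul0r min_r// powR0 ?gt_eqF//.
apply: (@le_trans _ _ (\int[mu]_x ((w j x `^ q)%:E +
    ((j.+1%:R * c) `^ q)%:E * (\1_[set x | (j%:R * c < `|f x|)%R] x)%:E))%E).
  apply: ge0_le_integral => //.
  - by move=> x _; rewrite lee_fin powR_ge0.
  - apply/measurable_EFinP; exact: (mw j.+1).
  - apply/measurable_EFinP; apply: measurable_funD => //.
    exact: measurable_funM.
  move=> x _; rewrite -EFinM -EFinD lee_fin indicE.
  case: (boolP (x \in _)) => [_|/negP fx].
    rewrite mulr1 -[leLHS]add0r; apply: lerD; first exact: powR_ge0.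
    apply: ge0_ler_powR; rewrite ?nnegrE ?(ltW q0)//; first exact: w0.
      by rewrite mulr_ge0// ltW.
    by rewrite ge_min lexx orbT.
  rewrite mulr0 addr0; have {}fx : `|f x| <= j%:R * c.
    by rewrite leNgt; apply/negP => fj; apply: fx; rewrite inE.
  by rewrite /w !min_l// (le_trans fx)// ler_pM2r// ler_nat.
rewrite ge0_integralD//; last 4 first.
- by move=> x _; rewrite lee_fin powR_ge0.
- exact/measurable_EFinP.
- by move=> x _; rewrite -EFinM lee_fin mulr_ge0// powR_ge0.
- by apply/measurable_EFinP; exact: measurable_funM.
rewrite ge0_integralZl//; last 2 first.
- exact/measurable_EFinP.
- by rewrite lee_fin powR_ge0.
rewrite integral_indic// setIT.
apply: (@le_trans _ _ ((c `^ q * V * (2 - 2 * 2^-1 ^+ j))%:E +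
    (c `^ q * V * 2^-1 ^+ j)%:E)%E); last first.
  rewrite -EFinD lee_fin -mulrDr ler_pM2l ?mulr_gt0// exprS.
  by rewrite le_eqVlt; apply/orP; left; apply/eqP; field.
apply: leeD => //.
apply: (@le_trans _ _ (((j.+1%:R * c) `^ q)%:E * (V * (2 `^ (q + 1))^-1 ^+ j)%:E)%E).
  by apply: lee_wpmul2l; [rewrite lee_fin powR_ge0|exact: fdecay].
rewrite -EFinM lee_fin powRM ?(ltW c0)//.
have jq : j.+1%:R `^ q <= (2 ^+ j) `^ q :> R.
  apply: ge0_ler_powR; rewrite ?nnegrE ?(ltW q0) ?exprn_ge0//.
  by rewrite -natrX ler_nat ltn_expl.
have -> : (2 `^ (q + 1))^-1 ^+ j = ((2 ^+ j) `^ q)^-1 * 2^-1 ^+ j :> R.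
  rewrite powRD; last by rewrite pnatr_eq0 implybT.
  rewrite powRr1// invfM exprMn; congr (_ * _).
  by rewrite exprVn -powR_mulrn ?powR_ge0// powRAC powR_mulrn.
have jp : 0 < (2 ^+ j) `^ q :> R by rewrite powR_gt0// exprn_gt0.
rewrite [leLHS](_ : _ = j.+1%:R `^ q / (2 ^+ j) `^ q * (c `^ q * V * 2^-1 ^+ j));
  last by ring.
rewrite ler_piMl//; last by rewrite ler_pdivrMr// mul1r.
by rewrite !mulr_ge0 ?(ltW cq0) ?(ltW V0)// exprn_ge0.
Qed.

End layers.

(** * From superlevel sets and integrals to norms on Omega *)

Section solution_support.
Context {R : realType} (n : nat).
Local Notation leb := (@lebesgue_rV R n).

Lemma Lp_norm_le (Omega : set 'rV[R]_n) (q B : R) (u : 'rV[R]_n -> R) :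
  open Omega -> measurable_fun setT u -> 0 < q -> 0 <= B ->
  (\int[leb]_x (`|u x| `^ q)%:E <= (B `^ q)%:E)%E ->
  (Lp_norm Omega q%:E u <= B%:E)%E.
Proof.
move=> /open_measurable_rV mO mu q0 B0 uB.
apply: (@le_trans _ _ ('N[leb]_q%:E[EFin \o u])%E).
  apply: le_Lnorm => //.
    by apply/(measurable_restrictT _ _).1 => //; exact: measurable_funTS.
  by move=> x; rewrite patchE; case: ifPn => // _; rewrite normr0.
rewrite unlock; have -> : B%:E = ((B `^ q)%:E `^ q^-1)%E.
  by rewrite poweR_EFin -powRrM divff ?gt_eqF// powRr1.
apply: gt0_ler_poweR.
- by rewrite invr_ge0 ltW.
- by rewrite in_itv/= leey andbT; apply: integral_ge0 => x _; rewrite lee_fin powR_ge0.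
- by rewrite in_itv/= leey andbT lee_fin powR_ge0.
- exact: uB.
Qed.

Lemma Linfty_norm_le (Omega : set 'rV[R]_n) (B : R) (u : 'rV[R]_n -> R) :
  measurable [set x | (B < `|u x|)%R] -> 0 <= B ->
  leb [set x | (B < `|u x|)%R] = 0%E ->
  (Lp_norm Omega +oo%E u <= B%:E)%E.
Proof.
move=> mB B0 uB; rewrite /Lp_norm unlock; case: ifPn => _; last by rewrite lee_fin.
apply/ess_supP; exists [set x | (B < `|u x|)%R]; split => // x /=.
rewrite patchE; case: ifPn => _; first by move=> /negP; rewrite lee_fin -ltNge.
by rewrite normr0 lee_fin B0.
Qed.

(** Up to a null set u lives in a cube containing [Omega]; this supplies the initial bound of both
    iterations. *)
Lemma superlevel_bound (Omega : set 'rV[R]_n) (M k : R) (u : 'rV[R]_n -> R) :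
  Omega `<=` cube M -> 0 < M -> 0 <= k -> vanishes_outside Omega u ->
  measurable [set x | (k < `|u x|)%R] ->
  (leb [set x | (k < `|u x|)%R] <= ((M *+ 2) ^+ n)%:E)%E.
Proof.
move=> OM M0 k0 [N [mN N0 uN]] mk.
apply: (@le_trans _ _ (leb (N `|` cube M))).
  apply: le_measure; rewrite ?inE//.
    by apply: measurableU => //; exact: measurable_cube.
  move=> x /= ux; have [Ox|Ox] := pselect (Omega x); [by right; exact: OM|left].
  apply: uN => /= /(_ Ox) u0; move: ux.
  by rewrite u0 normr0 ltNge k0.
rewrite -(lebesgue_cube n M0) -[leRHS]add0e -N0.
by apply: measureU2 => //; exact: measurable_cube.
Qed.

End solution_support.

(** * The supercritical and critical cases *)

Section parts_bc.
Context {R : realType} (n : nat) (s Lambda1 Lambda2 : R).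
Hypotheses (n_gt0 : (0 < n)%N) (s_gt0 : 0 < s).
Hypotheses (Lambda1_gt0 : 0 < Lambda1) (Lambda2_gt0 : 0 < Lambda2).
Local Notation leb := (@lebesgue_rV R n).
Local Notation tail := (tail_const n s Lambda1 Lambda2).

Let tail_gt0 : 0 < tail.
Proof. exact: tail_const_gt0. Qed.

Let nr_gt0 : 0 < n%:R :> R.
Proof. by rewrite ltr0n. Qed.

Lemma in_Lp_norm_lty Omega p (f : 'rV[R]_n -> R) :
  in_Lp Omega p f -> (Lp_norm Omega p f < +oo)%E.
Proof. by move=> /andP[_]; rewrite inE. Qed.

Lemma superlevel_nd (u : 'rV[R]_n -> R) :
  (forall k, measurable [set x | (k < `|u x|)%R]) ->
  {homo (fun k => leb [set x | (k < `|u x|)%R]) : x y / x <= y >-> (y <= x)%E}.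
Proof.
move=> mu x y xy; apply: le_measure; rewrite ?inE// => z /=.
exact: le_lt_trans.
Qed.

Lemma solution_Linfty_bound (p : R) (Omega : set 'rV[R]_n) :
  1 <= p -> n%:R / (2 * s) < p -> bounded_domain Omega ->
  exists2 C : R, 0 < C &
    forall a g u : 'rV[R]_n -> R,
      admissible_kernel s Lambda1 Lambda2 a ->
      in_Lp Omega 2%:E g ->
      weak_solution s a Omega g u ->
      in_Lp Omega p%:E g ->
      (Lp_norm Omega +oo%E u <= C%:E * Lp_norm Omega p%:E g)%E.
Proof.
move=> p1 np [_ oO _ /bounded_sub_cube[M M0 OM]].
have p0 : 0 < p by exact: lt_le_trans p1.
pose V : R := (M *+ 2) ^+ n.
have V0 : 0 < V by rewrite exprn_gt0// pmulrn_lgt0.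
(* The exponent in [superlevel_decay] is 1 + theta, and theta > 0 says exactly that p > n/(2s). *)
pose theta : R := 2 * s / n%:R - p^-1.
have t0 : 0 < theta.
  rewrite subr_gt0 -[2 * s / _]invf_div ltf_pV2// posrE divr_gt0//.
  by rewrite mulr_gt0.
pose C : R := 2 * V `^ theta * 2 `^ theta^-1 / tail.
have C0 : 0 < C by rewrite divr_gt0// !mulr_gt0// powR_gt0.
exists C => // a g u adm g2 usol gp.
have [_ uO _] := usol.
have mset k := measurable_superlevel usol k.
apply: lee_scale_of_lt => //; first exact: Lnorm_ge0.
  exact: in_Lp_norm_lty.
move=> N N0 gN.
have CN : C * N = N / tail * (2 * V `^ theta * 2 `^ theta^-1).
  by rewrite /C; ring.
apply: Linfty_norm_le => //; first by rewrite mulr_ge0// ltW.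
rewrite CN; apply: (stampacchia (m := fun k => leb [set x | (k < `|u x|)%R])) => //.
- by rewrite divr_gt0.
- by apply: superlevel_nd.
- exact: (superlevel_bound OM).
move=> h k b k0 kh b0 ub.
have := superlevel_decay n_gt0 s_gt0 Lambda1_gt0 Lambda2_gt0 adm g2 usol p1
  (ltW N0) gp gN k0 kh b0 ub.
by rewrite (_ : 1 - p^-1 + 2 * s / n%:R = 1 + theta)// /theta; ring.
Qed.

Lemma solution_Lq_bound_critical (p q : R) (Omega : set 'rV[R]_n) :
  1 <= p -> p = n%:R / (2 * s) -> 1 <= q -> bounded_domain Omega ->
  exists2 C : R, 0 < C &
    forall a g u : 'rV[R]_n -> R,
      admissible_kernel s Lambda1 Lambda2 a ->
      in_Lp Omega 2%:E g ->
      weak_solution s a Omega g u ->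
      in_Lp Omega p%:E g ->
      (Lp_norm Omega q%:E u <= C%:E * Lp_norm Omega p%:E g)%E.
Proof.
move=> p1 np q1 [_ oO _ /bounded_sub_cube[M M0 OM]].
have q0 : 0 < q by exact: lt_le_trans q1.
pose V : R := (M *+ 2) ^+ n.
have V0 : 0 < V by rewrite exprn_gt0// pmulrn_lgt0.
(* The decay ratio required by [integral_powR_le_of_decay] for the exponent [q]. *)
pose K : R := 2 `^ (q + 1).
have K1 : 1 < K.
  apply: (@le_lt_trans _ _ (1 `^ (q + 1))); first by rewrite powR1.
  by apply: gt0_ltr_powR; rewrite ?nnegrE ?addr_gt0// ltr1n.
have K0 : 0 < K by lra.
pose C : R := K * (V * 2) `^ q^-1 / tail.
have C0 : 0 < C by rewrite divr_gt0// !mulr_gt0// powR_gt0// mulr_gt0.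
exists C => // a g u adm g2 usol gp.
have [_ uO _] := usol.
have mset k := measurable_superlevel usol k.
have mu := weak_solution_measurable usol.
apply: lee_scale_of_lt => //; first exact: Lnorm_ge0.
  exact: in_Lp_norm_lty.
move=> N N0 gN.
have A0 : 0 < N / tail by rewrite divr_gt0.
have decay := geometric_decay (m := fun k => leb [set x | (k < `|u x|)%R]) A0 V0 K1.
have AK0 : 0 < N / tail * K by rewrite mulr_gt0.
apply: Lp_norm_le => //; first by rewrite mulr_ge0// ltW.
have -> : (C * N) `^ q = (N / tail * K) `^ q * V * 2.
  rewrite (_ : C * N = N / tail * K * (V * 2) `^ q^-1); last by rewrite /C; ring.
  rewrite (@powRM _ (N / tail * K)) ?powR_ge0 ?(ltW AK0)// -powRrM mulVf ?gt_eqF//.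
  by rewrite powRr1 ?mulrA// mulr_ge0// ltW.
apply: integral_powR_le_of_decay => // j; apply: decay.
  exact: (superlevel_bound OM).
move=> h k b k0 kh b0 ub.
have := superlevel_decay n_gt0 s_gt0 Lambda1_gt0 Lambda2_gt0 adm g2 usol p1
  (ltW N0) gp gN k0 kh b0 ub.
(* At the critical exponent the decay estimate is linear in [b], as [geometric_decay] requires. *)
have -> : 1 - p^-1 + 2 * s / n%:R = 1.
  by rewrite np invf_div subrK.
by rewrite powRr1// ltW.
Qed.

End parts_bc.

(** * Power cut-offs and exponent arithmetic *)

Lemma powR_sub_le (R : realType) (e M b x y : R) : 0 < e -> 0 <= b ->
  e <= y -> y <= x -> x <= M ->
  x `^ b - y `^ b <= M `^ b * b / e * (x - y).
Proof.
move=> e0 b0 ey yx xM.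
have y0 : 0 < y by exact: lt_le_trans ey.
have x0 : 0 < x by exact: lt_le_trans yx.
(* The difference of powers is x^b (1 - exp(-b (ln x - ln y))); applying 1 + z <= exp z twice bounds
   it by x^b b (x - y) / e. *)
have yb : y `^ b = x `^ b * expR (b * (ln y - ln x)).
  by rewrite /powR (gt_eqF x0) (gt_eqF y0) -expRD; congr expR; ring.
have lnxy : ln x - ln y <= (x - y) / e.
  have -> : ln x - ln y = ln (x / y) by rewrite ln_div// posrE.
  have xy0 : 0 < x / y by rewrite divr_gt0.
  have := expR_ge1Dx (ln (x / y)); rewrite lnK ?posrE// => H.
  have : x / y - 1 <= (x - y) / e.
    rewrite (_ : x / y - 1 = (x - y) / y); last by field; rewrite gt_eqF.
    by rewrite ler_wpM2l ?subr_ge0// lef_pV2 ?posrE.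
  lra.
have E1 := expR_ge1Dx (b * (ln y - ln x)).
have xb0 : 0 < x `^ b by rewrite powR_gt0.
have xbM : x `^ b <= M `^ b.
  by apply: ge0_ler_powR; rewrite ?nnegrE// ltW// (lt_le_trans x0).
have z0 : 0 <= (x - y) / e by rewrite divr_ge0 ?subr_ge0// ltW.
apply: (@le_trans _ _ (x `^ b * (b * ((x - y) / e)))).
  rewrite yb -[X in X - _]mulr1 -mulrBr ler_pM2l//.
  have : b * (ln x - ln y) <= b * ((x - y) / e) by rewrite ler_wpM2l.
  lra.
rewrite (_ : M `^ b * b / e * (x - y) = M `^ b * (b * ((x - y) / e))); last by ring.
by rewrite ler_wpM2r// mulr_ge0.
Qed.

(** The cut at [e] gives a Lipschitz function even for b < 1, the cut at [M] even for b > 1.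
    Subtracting e^b makes it vanish up to [e] and cancels in differences. *)
Definition power_cut (R : realType) (e M b t : R) : R :=
  Num.min (Num.max t e) M `^ b - e `^ b.

Section power_cut.
Context {R : realType} (e M b : R).
Hypotheses (e0 : 0 < e) (eM : e <= M) (b0 : 0 <= b).

Let cut (t : R) := Num.min (Num.max t e) M.

Let cut_bounds t : e <= cut t <= M.
Proof. by rewrite /cut le_min le_max lexx orbT eM ge_min lexx orbT. Qed.

Let cut_nd : {homo cut : x y / x <= y}.
Proof.
move=> x y xy; rewrite /cut le_min !ge_min ge_max !le_max lexx xy/= orbT.
by rewrite lexx orbT.
Qed.

Let cut_lip x y : y <= x -> cut x - cut y <= x - y.
Proof.
move=> yx; rewrite lerBlDl -lerBlDr [leRHS]/cut le_min; apply/andP; split.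
  rewrite lerBlDr; apply: (@le_trans _ _ (Num.max x e)).
    by rewrite /cut ge_min lexx.
  rewrite ge_max; apply/andP; split.
    by rewrite addrC -lerBlDl (_ : _ - _ = y)// ?le_max ?lexx//; ring.
  by rewrite -[leLHS]addr0; apply: lerD; rewrite ?subr_ge0// le_max lexx orbT.
by rewrite lerBlDr -[leLHS]addr0; apply: lerD; rewrite ?subr_ge0//;
  have /andP[] := cut_bounds x.
Qed.

Lemma measurable_power_cut : measurable_fun setT (power_cut e M b).
Proof.
apply: measurable_funB => //; apply: measurable_comp_powR.
by apply: measurable_minr => //; apply: measurable_maxr.
Qed.

Lemma power_cut_nd : {homo power_cut e M b : x y / x <= y}.
Proof.
move=> x y xy; rewrite /power_cut lerD2r; apply: ge0_ler_powR => //.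
- by rewrite nnegrE (le_trans (ltW e0))//; have /andP[] := cut_bounds x.
- by rewrite nnegrE (le_trans (ltW e0))//; have /andP[] := cut_bounds y.
exact: cut_nd.
Qed.

Lemma power_cut_eq0 t : t <= e -> power_cut e M b t = 0.
Proof. by move=> te; rewrite /power_cut max_r// min_l// subrr. Qed.

Lemma power_cutE t : e <= t -> power_cut e M b t = Num.min t M `^ b - e `^ b.
Proof. by move=> et; rewrite /power_cut max_l. Qed.

Lemma power_cut_lipschitz x y :
  `|power_cut e M b x - power_cut e M b y| <= M `^ b * b / e * `|x - y|.
Proof.
wlog xy : x y / y <= x.
  move=> W; have [/W//|/ltW/W] := leP y x.
  by rewrite distrC (distrC x y).
rewrite !ger0_norm ?subr_ge0 ?power_cut_nd//.
have -> : power_cut e M b x - power_cut e M b y = cut x `^ b - cut y `^ b.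
  by rewrite /power_cut -/(cut x) -/(cut y); ring.
have /andP[ex xM] := cut_bounds x; have /andP[ey yM] := cut_bounds y.
apply: (le_trans (powR_sub_le e0 b0 ey (cut_nd xy) xM)).
by rewrite ler_wpM2l ?cut_lip// divr_ge0 ?(ltW e0)// mulr_ge0// powR_ge0.
Qed.

End power_cut.

Section powR_calculations.
Context {R : realType}.

(** The lower bound of the energy for the levels w and w/2, with the Chebyshev bound (w/2)^(-q) J
    for the measure; the powers of [w] add up to 1 + b + q t = q. *)
Lemma half_power_gap (w J tl b q t E : R) : 0 < w -> 0 < J -> 1 + b + q * t = q ->
  (w - w / 2) * ((w `^ b - E) - ((w / 2) `^ b - E)) *
    (tl * ((w / 2) `^ (- q) * J) `^ (- t)) =
  (2^-1 * (1 - 2^-1 `^ b) * 2^-1 `^ (q * t) * tl) * J `^ (- t) * w `^ q.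
Proof.
move=> w0 J0 qE.
have wE : w `^ q = w * w `^ b * w `^ (q * t).
  rewrite -{1}qE !powRD ?(gt_eqF w0) ?implybT// powRr1// ltW//.
have w2 : 0 <= w / 2 by rewrite divr_ge0// ltW.
rewrite [((w / 2) `^ (- q) * J) `^ (- t)]powRM ?powR_ge0 ?(ltW J0)//.
rewrite -powRrM mulrNN ![(w / 2) `^ _]powRM ?(ltW w0)// wE.
by field.
Qed.

(** Dividing by the positive finite J^(1-1/p) leaves J^(1/p-t) = J^(1/q) on the left. *)
Lemma self_improvement (J N c t p q : R) : 0 < J -> 0 < c -> 0 < q ->
  p^-1 - t = q^-1 -> c * J `^ (- t) * (J / 2) <= N * J `^ (1 - p^-1) ->
  J <= (2 / c * N) `^ q.
Proof.
move=> J0 c0 q0 qE H.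
have JE : J `^ (- t) * J = J `^ (1 - p^-1) * J `^ q^-1.
  rewrite -{2}(powRr1 (ltW J0)) -!powRD ?(gt_eqF J0) ?implybT//.
  by congr (_ `^ _); rewrite -qE; ring.
have P0 : 0 < J `^ (1 - p^-1) by rewrite powR_gt0.
have Jq : J `^ q^-1 <= 2 / c * N.
  rewrite -(ler_pM2l P0) -JE.
  rewrite (_ : _ * (2 / c * N) = 2 / c * (N * J `^ (1 - p^-1))); last by ring.
  rewrite [leLHS](_ : _ = 2 / c * (c * J `^ (- t) * (J / 2))).
    by rewrite ler_pM2l// divr_gt0.
  by field; rewrite gt_eqF.
have {1}-> : J = (J `^ q^-1) `^ q by rewrite -powRrM mulVf ?gt_eqF// powRr1// ltW.
apply: ge0_ler_powR; rewrite ?nnegrE ?powR_ge0 ?(ltW q0)//.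
by rewrite (le_trans _ Jq)// powR_ge0.
Qed.

End powR_calculations.

(** Because r <= M, the truncation at [M] is still at least [r] wherever |f| > r. *)
Lemma truncated_chebyshev d (T : measurableType d) (R : realType)
    (mu : {measure set T -> \bar R}) (f : T -> R) (M q J r : R) :
  measurable_fun setT f -> 0 < q -> 0 < r -> r <= M ->
  (\int[mu]_x (Num.min `|f x| M `^ q)%:E <= J%:E)%E ->
  measurable [set x | (r < `|f x|)%R] ->
  (mu [set x | (r < `|f x|)%R] <= (r `^ (- q) * J)%:E)%E.
Proof.
move=> mf q0 r0 rM fJ mS.
have M0 : 0 < M by exact: lt_le_trans rM.
have rq0 : 0 < r `^ q by rewrite powR_gt0.
have H : ((r `^ q)%:E * mu [set x | (r < `|f x|)%R] <= J%:E)%E.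
  apply: le_trans fJ; rewrite -[X in mu X]setIT -integral_indic//.
  rewrite -ge0_integralZl//; last 2 first.
  - by apply/measurable_EFinP.
  - by rewrite lee_fin ltW.
  apply: ge0_le_integral => //.
  - by move=> x _; rewrite -EFinM lee_fin mulr_ge0// ltW.
  - by apply/measurable_EFinP; exact: measurable_funM.
  - apply/measurable_EFinP/measurable_comp_powR/measurable_minr => //.
    exact: measurableT_comp.
  move=> x _; rewrite -EFinM lee_fin indicE.
  case: (boolP (x \in _)) => [/set_mem/= rx|_]; last by rewrite mulr0 powR_ge0.
  rewrite mulr1; apply: ge0_ler_powR; rewrite ?nnegrE ?(ltW q0) ?(ltW r0)//.
    by rewrite le_min normr_ge0 ltW.
  by rewrite le_min rM andbT ltW.
rewrite powRN -(@lee_pmul2l _ (r `^ q)%:E)// -EFinM mulrA divff ?gt_eqF//.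
by rewrite mul1r.
Qed.

(** * The subcritical case *)

Section part_a.
Context {R : realType} (n : nat) (s Lambda1 Lambda2 : R).
Hypotheses (n_gt0 : (0 < n)%N) (s_gt0 : 0 < s).
Hypotheses (Lambda1_gt0 : 0 < Lambda1) (Lambda2_gt0 : 0 < Lambda2).
Local Notation leb := (@lebesgue_rV R n).
Local Notation tail := (tail_const n s Lambda1 Lambda2).

Variable p : R.
Hypotheses (p_gt1 : 1 < p) (p_lt : p < n%:R / (2 * s)).

Let q := n%:R * p / (n%:R - 2 * p * s).
(** This is q (p - 1) / p, so the power b of |u| raised to the conjugate exponent p / (p - 1) is
    |u|^q; it also satisfies 1 + b + q t = q. *)
Let b := n%:R * (p - 1) / (n%:R - 2 * p * s).
Let t := 2 * s / n%:R.

Let nr_gt0 : 0 < n%:R :> R.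
Proof. by rewrite ltr0n. Qed.

Let p_gt0 : 0 < p.
Proof. exact: lt_trans p_gt1. Qed.

Let den_gt0 : 0 < n%:R - 2 * p * s.
Proof.
by move: p_lt; rewrite ltr_pdivlMr ?mulr_gt0// => ?; lra.
Qed.

Let q_gt0 : 0 < q.
Proof. by rewrite divr_gt0// mulr_gt0. Qed.

Let b_gt0 : 0 < b.
Proof. by rewrite divr_gt0// mulr_gt0// subr_gt0. Qed.

Let exponentE : 1 + b + q * t = q.
Proof. by rewrite /b /q /t; field; rewrite !gt_eqF. Qed.

Let qVE : p^-1 - t = q^-1.
Proof. by rewrite /q /t; field; rewrite !gt_eqF. Qed.

Let bpE : b * (p / (p - 1)) = q.
Proof. by rewrite /b /q; field; rewrite !gt_eqF// subr_gt0. Qed.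

Definition sobolev_const : R :=
  2^-1 * (1 - 2^-1 `^ b) * 2^-1 `^ (q * t) * tail.

Lemma sobolev_const_gt0 : 0 < sobolev_const.
Proof.
have h0 : 0 < 2^-1 :> R by rewrite invr_gt0.
have hb : 2^-1 `^ b < 1.
  apply: (@lt_le_trans _ _ (1 `^ b)); last by rewrite powR1.
  by apply: gt0_ltr_powR; rewrite ?nnegrE// invf_lt1// ltr1n.
apply: mulr_gt0; last exact: tail_const_gt0.
apply: mulr_gt0; last exact: powR_gt0.
by rewrite mulr_gt0// subr_gt0.
Qed.

Variables (Omega : set 'rV[R]_n) (a g u : 'rV[R]_n -> R).
Hypothesis dom : bounded_domain Omega.
Hypothesis adm : admissible_kernel s Lambda1 Lambda2 a.
Hypothesis g2 : in_Lp Omega 2%:E g.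
Hypothesis usol : weak_solution s a Omega g u.
Hypothesis gp : in_Lp Omega p%:E g.
Variable N : R.
Hypotheses (N_gt0 : 0 < N) (gN : (Lp_norm Omega p%:E g <= N%:E)%E).

(** Truncating at [M] makes the integral [J] finite, so it can be absorbed by [self_improvement];
    the resulting bound depends neither on [M] nor on [Omega]. *)
Lemma truncated_Lq_bound (M : R) : 0 < M ->
  (\int[leb]_x (Num.min `|u x| M `^ q)%:E <=
   ((2 / sobolev_const * N) `^ q)%:E)%E.
Proof.
move=> M0; have c0 := sobolev_const_gt0.
have [_ _ _ /bounded_sub_cube[Mc Mc0 OMc]] := dom.
have [_ uO _] := usol.
have mu := weak_solution_measurable usol.
have mset k := measurable_superlevel usol k.
have mg := in_Lp_measurable gp.
pose V : R := (Mc *+ 2) ^+ n.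
have V0 : 0 < V by rewrite exprn_gt0// pmulrn_lgt0.
have SV : (leb [set x | (0 < `|u x|)%R] <= V%:E)%E by exact: (superlevel_bound OMc).
pose w x := Num.min `|u x| M.
have w0 x : 0 <= w x by rewrite le_min normr_ge0 ltW.
have wq0 x : 0 <= w x `^ q by exact: powR_ge0.
have mw : measurable_fun setT (fun x => w x `^ q).
  by apply/measurable_comp_powR/measurable_minr => //; exact: measurableT_comp.
have support_bound r : 0 <= r ->
    (\int[leb]_x (r%:E * (\1_[set x | (0 < `|u x|)%R] x)%:E) <= (r * V)%:E)%E.
  move=> r0; rewrite ge0_integralZl//; last exact/measurable_EFinP.
  by rewrite integral_indic// setIT EFinM lee_wpmul2l// lee_fin.
have w_small r x : `|u x| <= r -> w x `^ q <= r `^ q * \1_[set x | (0 < `|u x|)%R] x.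
  move=> ur; rewrite indicE; case: (boolP (x \in _)) => [_|/negP ux].
    rewrite mulr1; apply: ge0_ler_powR; rewrite ?nnegrE ?(ltW q_gt0)//.
      exact: le_trans ur.
    by rewrite (le_trans _ ur)// ge_min lexx.
  rewrite mulr0 /w (_ : `|u x| = 0) ?min_l ?(ltW M0)// ?powR0 ?gt_eqF//.
  by apply/eqP; rewrite eq_le normr_ge0 andbT leNgt; apply/negP => ?;
    apply: ux; rewrite inE.
have JM : (\int[leb]_x (w x `^ q)%:E <= (M `^ q * V)%:E)%E.
  apply: le_trans (support_bound _ (powR_ge0 M q)).
  apply: ge0_le_integral => //.
  - by move=> x _; rewrite lee_fin.
  - exact/measurable_EFinP.
  - by apply/measurable_EFinP; exact: measurable_funM.
  move=> x _; rewrite -EFinM lee_fin.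
  have [uM|/ltW Mu] := leP `|u x| M; first exact: w_small.
  rewrite /w min_r// indicE mem_set ?mulr1//=.
  exact: lt_le_trans Mu.
have [|J JE /andP[J_ge0 JMV]] := ge0_le_EFin _ JM.
  by apply: integral_ge0 => x _; rewrite lee_fin.
rewrite -/(w _) JE lee_fin.
have [J0|J0] := leP J 0; first by rewrite (le_trans J0)// powR_ge0.
(* The set {|u| <= e2} carries at most half of J. *)
pose e2 := (J / (2 * V)) `^ q^-1.
have JV0 : 0 < J / (2 * V) by rewrite divr_gt0// mulr_gt0.
have e20 : 0 < e2 by rewrite powR_gt0.
have e2q : e2 `^ q * V = J / 2.
  rewrite /e2 -powRrM mulVf ?gt_eqF// powRr1 ?(ltW JV0)//.
  by field; rewrite gt_eqF.
(* Follows from J <= M^q V; it ensures w >= e2 on [S]. *)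
have e2M : e2 <= M.
  rewrite -[leRHS](powRr1 (ltW M0)) -(@divff _ q) ?gt_eqF// powRrM.
  apply: ge0_ler_powR; rewrite ?nnegrE ?invr_ge0 ?powR_ge0 ?(ltW q_gt0) ?(ltW JV0)//.
  rewrite ler_pdivrMr ?mulr_gt0// (le_trans JMV)//.
  by rewrite ler_wpM2l ?powR_ge0// ler_peMl ?(ltW V0)// ler1n.
(* Half of [e2], so that on [S] both levels w and w/2 lie in the range where [psi] is the power b
   minus a constant. *)
pose e := e2 / 2.
have e0 : 0 < e by rewrite divr_gt0.
have eM : e <= M by rewrite /e; lra.
pose S : set 'rV[R]_n := [set x | (e2 < `|u x|)%R].
have mS : measurable S by exact: mset.
have mwS : measurable_fun setT (fun x => w x `^ q * \1_S x) by exact: measurable_funM.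
pose psi := power_cut e M b.
have psi_nd := power_cut_nd e0 eM (ltW b_gt0).
have psi_le0 r : r <= 0 -> psi r = 0.
  by move=> r0; apply: power_cut_eq0 => //; rewrite (le_trans r0)// ltW.
have psi0 r : 0 <= psi r.
  have [/psi_le0->//|r0] := leP r 0.
  by rewrite -(psi_le0 0)//; apply/psi_nd/ltW.
pose H x := sobolev_const * J `^ (- t) * (w x `^ q * \1_S x).
have cJ0 : 0 <= sobolev_const * J `^ (- t) by rewrite mulr_ge0 ?powR_ge0// ltW.
have mH : measurable_fun setT H by exact: measurable_funM.
have H0 x : 0 <= H x by rewrite mulr_ge0// mulr_ge0.
have energy := energy_estimate_abs n_gt0 s_gt0 Lambda1_gt0 Lambda2_gt0 adm g2 usol
  (measurable_power_cut e M b) psi_nd psi_le0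
  (power_cut_lipschitz e0 eM (ltW b_gt0)) mH H0.
have HJ : (\int[leb]_x (H x)%:E <= \int[leb]_x (`|(g \_ Omega) x| * psi `|u x|)%:E)%E.
  apply: energy => x; rewrite /H indicE.
  case: (boolP (x \in S)) => [/set_mem Sx|_]; last by left; rewrite !mulr0.
  right; have wx : e2 <= w x by rewrite le_min e2M andbT ltW.
  have wx0 : 0 < w x by exact: lt_le_trans wx.
  have wM : w x <= M by rewrite ge_min lexx orbT.
  have wh : w x / 2 <= w x by lra.
  exists (w x), (w x / 2), ((w x / 2) `^ (- q) * J); split.
  - by rewrite wh andbT divr_ge0.
  - by rewrite ge_min lexx.
  - by rewrite mulr_gt0// powR_gt0// divr_gt0.
  - apply: (truncated_chebyshev (M := M)) (mset _) => //; first by rewrite divr_gt0.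
      exact: (le_trans wh wM).
    by rewrite -/(w _) JE.
  rewrite mulr1 /psi !power_cutE//; last 2 first.
  - by rewrite /e; lra.
  - by rewrite /e; lra.
  rewrite !min_l//; last by rewrite (le_trans wh).
  by rewrite half_power_gap.
have RHS : (\int[leb]_x (`|(g \_ Omega) x| * psi `|u x|)%:E <=
    (N * J `^ (1 - p^-1))%:E)%E.
  have mpu : measurable_fun setT (fun x => psi `|u x|).
    apply: measurableT_comp; first exact: measurable_power_cut.
    exact: measurableT_comp.
  have -> : (\int[leb]_x (`|(g \_ Omega) x| * psi `|u x|)%:E =
      \int[leb]_x (`|(g \_ Omega) x| * `|psi `|u x| |)%:E)%E.
    by apply: eq_integral => x _; rewrite (ger0_norm (psi0 _)).
  (* It remains to see that [psi] of |u|, raised to p / (p - 1), is at most w^q, whose integral is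
     [J]. *)
  apply: hoelder_integral => //; first exact: ltW.
  rewrite -JE; apply: ge0_le_integral => //.
  - by apply/measurable_EFinP/measurable_comp_powR; exact: measurableT_comp.
  - exact/measurable_EFinP.
  move=> x _; rewrite lee_fin ger0_norm// -bpE [leRHS]powRrM.
  apply: ge0_ler_powR; rewrite ?nnegrE ?powR_ge0//.
    by rewrite divr_ge0 ?(ltW p_gt0)// subr_ge0 ltW.
  have [ue|/ltW eu] := leP `|u x| e; first by rewrite /psi power_cut_eq0 ?powR_ge0.
  by rewrite /psi power_cutE// gerBl powR_ge0.
have XJ : (\int[leb]_x (w x `^ q * \1_S x)%:E <= J%:E)%E.
  rewrite -JE; apply: ge0_le_integral => //.
  - by move=> x _; rewrite lee_fin mulr_ge0.
  - exact/measurable_EFinP.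
  - exact/measurable_EFinP.
  by move=> x _; rewrite lee_fin ler_piMr.
have [|X XE _] := ge0_le_EFin _ XJ.
  by apply: integral_ge0 => x _; rewrite lee_fin mulr_ge0.
(* Off [S] the integrand is at most e2^q on the support of u, which contributes at most e2^q V = J /
   2. *)
have JX : J / 2 <= X.
  have : (J%:E <= X%:E + (e2 `^ q * V)%:E)%E.
    rewrite -JE -XE; apply: le_trans (leeD2l _ (support_bound _ (powR_ge0 e2 q))).
    rewrite -ge0_integralD//; last 4 first.
    - by move=> x _; rewrite lee_fin mulr_ge0.
    - exact/measurable_EFinP.
    - by move=> x _; rewrite -EFinM lee_fin mulr_ge0// powR_ge0.
    - by apply/measurable_EFinP; exact: measurable_funM.
    apply: ge0_le_integral => //.
    - by move=> x _; rewrite lee_fin.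
    - exact/measurable_EFinP.
    - by apply/measurable_EFinP; apply: measurable_funD => //; exact: measurable_funM.
    move=> x _; rewrite -EFinM -EFinD lee_fin [\1_S x]indicE.
    case: (boolP (x \in S)) => [_|/negP Sx].
      by rewrite mulr1 lerDl mulr_ge0// powR_ge0.
    rewrite mulr0 add0r; apply: w_small; rewrite leNgt; apply/negP => ?.
    by apply: Sx; rewrite inE.
  by rewrite -EFinD lee_fin e2q; lra.
apply: (self_improvement (t := t) (p := p)) => //.
have := le_trans HJ RHS; rewrite /H.
under eq_integral do rewrite EFinM.
rewrite ge0_integralZl//; last 2 first.
- exact/measurable_EFinP.
- by move=> x _; rewrite lee_fin mulr_ge0.
rewrite XE -EFinM lee_fin; apply: le_trans.
by rewrite ler_wpM2l.
Qed.

Lemma solution_Lq_bound_subcritical :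
  (Lp_norm Omega q%:E u <= (2 / sobolev_const * N)%:E)%E.
Proof.
have c0 := sobolev_const_gt0.
have mu := weak_solution_measurable usol.
have [_ oO _ _] := dom.
have C0 : 0 <= 2 / sobolev_const * N by rewrite mulr_ge0 ?divr_ge0// ltW.
apply: Lp_norm_le => //.
apply: (@integral_powR_le_trunc _ _ _ _ _ 1) => // j; rewrite mulr1.
(* The truncation at level 0 is identically 0 and is treated apart, as [truncated_Lq_bound] asks for
   M > 0. *)
case: j => [|j]; last exact: truncated_Lq_bound.
rewrite (_ : (fun x => _) = cst 0%E) ?integral0 ?lee_fin ?powR_ge0//.
apply/funext => x; rewrite (min_r (normr_ge0 _)) powR0//.
by rewrite gt_eqF.
Qed.

End part_a.

(** * The three integrability regimes together *)

Theorem proposition1p2 (R : realType) (n : nat) (s Lambda1 Lambda2 : R) :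
  (0 < n)%N -> 0 < s -> s < 1 -> 0 < Lambda1 -> 0 < Lambda2 ->
  [/\ (* (a) *)
      forall p : R, 1 < p -> p < n%:R / (2 * s) ->
      exists2 C : R, 0 < C &
        forall (Omega : set 'rV[R]_n) (a g u : 'rV[R]_n -> R),
          bounded_domain Omega ->
          admissible_kernel s Lambda1 Lambda2 a ->
          in_Lp Omega 2%:E g ->
          weak_solution s a Omega g u ->
          in_Lp Omega p%:E g ->
          (Lp_norm Omega (n%:R * p / (n%:R - 2 * p * s))%:E u
             <= C%:E * Lp_norm Omega p%:E g)%E,
      (* (b) *)
      forall (p q : R) (Omega : set 'rV[R]_n),
        1 <= p -> p = n%:R / (2 * s) -> 1 <= q -> bounded_domain Omega ->
      exists2 C : R, 0 < C &
        forall a g u : 'rV[R]_n -> R,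
          admissible_kernel s Lambda1 Lambda2 a ->
          in_Lp Omega 2%:E g ->
          weak_solution s a Omega g u ->
          in_Lp Omega p%:E g ->
          (Lp_norm Omega q%:E u <= C%:E * Lp_norm Omega p%:E g)%E
    & (* (c) *)
      forall (p : R) (Omega : set 'rV[R]_n),
        1 <= p -> n%:R / (2 * s) < p -> bounded_domain Omega ->
      exists2 C : R, 0 < C &
        forall a g u : 'rV[R]_n -> R,
          admissible_kernel s Lambda1 Lambda2 a ->
          in_Lp Omega 2%:E g ->
          weak_solution s a Omega g u ->
          in_Lp Omega p%:E g ->
          (Lp_norm Omega +oo%E u <= C%:E * Lp_norm Omega p%:E g)%E ].
Proof.
move=> n0 s0 s1 L10 L20; split.
- move=> p p1 np; have c0 := sobolev_const_gt0 n0 s0 L10 L20 p1 np.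
  (* Chosen before [Omega]: the volume of the enclosing cube enters only the choice of the cut-off
     and not the final bound. *)
  exists (2 / sobolev_const n s Lambda1 Lambda2 p); first by rewrite divr_gt0.
  move=> Omega a g u dom adm g2 usol gp.
  apply: lee_scale_of_lt; first by rewrite divr_gt0.
  - exact: Lnorm_ge0.
  - exact: in_Lp_norm_lty.
  move=> N N0 gN.
  exact: (solution_Lq_bound_subcritical n0 s0 L10 L20 p1 np dom adm g2 usol gp).
- by move=> p q Omega *; exact: solution_Lq_bound_critical.
- by move=> p Omega *; exact: solution_Linfty_bound.
Qed.
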